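(* The strongly regular graph with parameters $(729,112,1,20)$ is unique up to isomorphism; that is, any two strongly regular graphs with parameters $(729,112,1,20)$ are isomorphic as graphs.
   Context: A strongly regular graph with parameters $(v,k,\lambda,\mu)$ is a finite simple undirected graph on $v$ vertices which is regular of valency $k$, such that each pair of (distinct) adjacent vertices has exactly $\lambda$ common neighbors and each pair of distinct nonadjacent vertices has exactly $\mu$ common neighbors. A graph with parameters $(729,112,1,20)$ is known to exist (the Games graph). *)

(* Defs.v *)
From mathcomp Require Import all_boot.

Set Implicit Arguments.
Unset Strict Implicit.
Unset Printing Implicit Defensive.

(* A finite simple undirected graph is an adjacency relation on a finType. *)
Definition simple_graph (T : finType) (e : rel T) : Prop :=
  symmetric e /\ irreflexive e.

Definition neighbors (T : finType) (e : rel T) (x : T) : {set T} :=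
  [set y | e x y].

Definition common_neighbors (T : finType) (e : rel T) (x y : T) : {set T} :=
  neighbors e x :&: neighbors e y.

Record strongly_regular (v k lambda mu : nat) (T : finType) (e : rel T)
    : Prop := StronglyRegular {
  srg_simple : simple_graph e;
  srg_order : #|T| = v;
  srg_valency : forall x : T, #|neighbors e x| = k;
  srg_adjacent : forall x y : T,
    x != y -> e x y -> #|common_neighbors e x y| = lambda;
  srg_nonadjacent : forall x y : T,
    x != y -> ~~ e x y -> #|common_neighbors e x y| = mu
}.

Definition graph_isomorphic (T1 T2 : finType) (e1 : rel T1) (e2 : rel T2)
    : Prop :=
  exists2 f : T1 -> T2, bijective f & forall x y : T1, e2 (f x) (f y) = e1 x y.

(* Main.v *)
(* Let E be the Gram matrix of the 112-dimensional eigenspace, up to scaling. *)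
(* Since E is a multiple of a projection, every vanishing norm is a linear    *)
(* relation between vertices; these relations turn the neighbourhood of each  *)
(* vertex u into an involution x |-> opp u x of the vertex set which is an    *)
(* automorphism, and the products of two such reflections form an elementary *)
(* abelian group of order 3^6 acting regularly. Hence the graph is the Cayley *)
(* graph of F_3^6 on a set C of 112 vectors, namely 56 projective points.     *)
(*                                                                            *)
(* A hyperplane contains 40 or 22 vectors of C. The sections of a             *)
(* 22-hyperplane have 4 or 10 vectors, and an exhaustive search shows that    *)
(* these intersection numbers characterize the 11-cap of PG(4,3). In a pencil *)
(* through a 4-vector section lies a second 22-hyperplane, so the two         *)
(* corresponding copies of the 11-cap determine C on two hyperplanes up to    *)
(* finitely many choices. The linear relations of the graph also show that,   *)
(* off a 22-hyperplane H, each vector outside C has exactly 5 translates by   *)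
(* C /\ H in C while each vector of C has none; a search based on these       *)
(* conditions finds every completion, and each is linearly equivalent to the  *)
(* first one.                                                                 *)

Require Import Defs.
From HB Require Import structures.
From mathcomp Require Import all_boot all_order all_fingroup all_algebra all_solvable
  all_character.
From mathcomp Require Import zify ring.

Set Implicit Arguments.
Unset Strict Implicit.
Unset Printing Implicit Defensive.
Import GRing.Theory Num.Theory.

(** * Translations of the graph *)

(** Every graph with these parameters is isomorphic to one explicit Cayley graph on F_3^6, with
    connection set [hill_set] ([hill_form]); two such graphs are therefore isomorphic to each other.

    Symmetry. The eigenvalues of the adjacency matrix are 112, 4 and -23, and [gram] is 729 times
    the projection onto the eigenspace of -23. A combination of vertices of norm 0 is thus
    orthogonal to every vertex ([gram_null]), which yields [gram_relation] and its counting form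
    [relation_count]. As lambda = 1, the neighbours of u are paired into mates; exchanging mates
    extends to an automorphism [opp u] of the whole graph ([opposite_exists], [opp_adj]). The
    symmetry [oppC] makes a product of two reflections of order dividing 3, and the products
    attached to edges commute ([tau_commute]). They generate an elementary abelian group that is
    regular on the vertices, whence [cayley_form].

    Geometry. On the Cayley graph the real parts of additive characters are eigenvectors, so the
    connection set meets a hyperplane in 40 or 22 vectors ([level_values]), and some hyperplane has
    22 ([exists_level22]). Its section has only intersections of size 4 or 10 and is linearly the
    11-cap [golay] ([golay_form], [section_form]). Two such hyperplanes are put in standard position
    by [normal_frame] and [second_section].

    Computation. [search_sound] says that a set obeying the constraints agrees with one of the
    states listed by [search]; a test passed by the whole list ([golay_checkP], [hill_checkP])
    therefore holds for that set. This identifies the 11-cap, and reduces every completion of the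
    two sections to [hill] ([cap_unique]). *)

Fact relation_arith (p q b1 b2 b3 b4 b5 b6 : nat) :
    (108 * (15 *+ b1 + 20 *+ b2 + 4 *+ b3 + 1 *+ b4)
     - 27 * (15 *+ b5 + 20 *+ b6 + 4 * p%:R + 1 * q%:R)
     + 4 * (15 + 20 + 20 * 4 + 20 * 1) = 0 :> int)%R ->
  4 * p + q + 15 * b5 + 20 * b6 = 20 + 60 * b1 + 80 * b2 + 16 * b3 + 4 * b4.
Proof. lia. Qed.

Fact paired_values_arith (m m' : int) : (0 <= m <= 3 -> 0 <= m' <= 3 ->
  m + m' <= 4 -> (4 * m ^+ 2 + m * m' - 12 * m) + (4 * m' ^+ 2 + m' * m - 12 * m') <= 0)%R.
Proof. by nia. Qed.

Fact paired_values_arith' (m : int) : (0 <= m <= 3 ->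
  (4 * m ^+ 2 + m * -1 - 12 * m) + (4 * (-1) ^+ 2 + -1 * m - 12 * -1) <= 16)%R.
Proof. by nia. Qed.

(** If no value reaches 4, all are at most 3, and a pair totals at most 4 even once a negative value
    -1 is raised to 0. A pair m, m' then contributes at most 0 to the sum of 4 m^2 + m m' - 12 m, or
    at most 16 if it contains the value -1. Summing [F v + F (i v)] over [s] gives 48 by the
    hypotheses, but at most 32 by these bounds. *)
Lemma paired_values (T : finType) (s : {set T}) (i : T -> T) (m : T -> int) :
    {in s, forall v, [/\ i v \in s, i v != v & i (i v) = v]} ->
    {in s, forall v, -1 <= m v <= 4}%R ->
    #|[set v in s | (m v < 0)%R]| <= 1 ->
    (\sum_(v in s) m v = 3)%R ->
    (\sum_(v in s) (4 * m v ^+ 2 + m v * m (i v)) = 60)%R ->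
  exists2 v, v \in s & m v = 4%R.
Proof.
move=> iP mP; set B := [set v in s | _] => B1 sum1 sum2.
have [/existsP[v /andP[vs /eqP mv4]]|/existsPn nm4] :=
  boolP [exists v, (v \in s) && (m v == 4%R)]; first by exists v.
exfalso.
have m3 v : v \in s -> (m v <= 3)%R.
  by move=> vs; have := mP v vs; have := nm4 v; rewrite vs /=; lia.
have iis : {in s &, injective i}.
  by move=> v v' vs v's /(congr1 i); case: (iP v vs) (iP v' v's) => _ _ -> [_ _ ->].
have sumi (F : T -> int) : (\sum_(v in s) F (i v) = \sum_(v in s) F v)%R.
  have im : i @: s = s.
    apply/eqP; rewrite eqEcard card_in_imset // leqnn andbT.
    by apply/subsetP=> _ /imsetP[v vs ->]; case: (iP v vs).
  by rewrite -[in RHS]im big_imset.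
pose b v : int := (v \in B : nat)%:R%R.
have sumb : (\sum_(v in s) b v <= 1)%R.
  rewrite /b -natr_sum -[1%R]/(1%:R)%R ler_nat; apply: leq_trans B1.
  rewrite -sum1_card [X in X <= _]big_mkcond [X in _ <= X]big_mkcond.
  by apply: leq_sum => v _; case: (v \in s); case: (v \in B).
have mb v : v \in s -> (0 <= m v + b v)%R.
  by move=> vs; rewrite /b inE vs; have := mP v vs; case: ltrP => /=; lia.
have m4 v : v \in s -> (m v + b v + (m (i v) + b (i v)) <= 4)%R.
  move=> vs; have [ivs niv _] := iP v vs.
  have : (\sum_(v in s) (m v + b v) <= 3 + 1)%R by rewrite big_split /= sum1 lerD2l.
  rewrite (bigD1 v) //= (bigD1 (i v)) ?ivs //=; apply: Order.POrderTheory.le_trans.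
  rewrite addrA lerDl; apply: sumr_ge0 => j /andP[/andP[js _] _]; exact: mb.
pose F v := (4 * m v ^+ 2 + m v * m (i v) - 12 * m v)%R.
have sumF : (\sum_(v in s) (F v + F (i v)) = 48)%R.
  by rewrite big_split sumi /F /= !sumrB -!mulr_sumr sum1 sum2.
have : (\sum_(v in s) (F v + F (i v)) <= \sum_(v in s) 16 * (b v + b (i v)))%R.
  apply: ler_sum => v vs; have [ivs niv iiv] := iP v vs; rewrite /F iiv.
  have := m4 v vs; have := mP v vs; have := mP _ ivs; have := m3 v vs; have := m3 _ ivs.
  have nB : ~~ ((v \in B) && (i v \in B)).
    apply/andP=> -[vB ivB]; move: B1; rewrite leqNgt => /negP[].
    rewrite (cardsD1 v) vB (cardsD1 (i v)) !inE niv.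
    by move: ivB; rewrite inE => ->.
  move: nB; rewrite /b !inE vs ivs /=.
  case: (ltrP (m v) 0%R) => [lt0|le0]; case: (ltrP (m (i v)) 0%R) => [lt0'|le0'] //= _ a1 a2 a3 a4 a5.
  - have -> : m v = (-1)%R by lia.
    by rewrite addrC; apply: paired_values_arith'; lia.
  - have -> : m (i v) = (-1)%R by lia.
    by apply: paired_values_arith'; lia.
  - by apply: paired_values_arith; lia.
rewrite sumF -mulr_sumr big_split sumi /=.
by move: sumb; move: (\sum_(v in s) b v)%R => S; lia.
Qed.

(** * The matching of mates on each neighbourhood *)

Section Graph.

Variables (T : finType) (e : rel T).
Hypothesis srg : strongly_regular 729 112 1 20 e.

Local Notation N := (neighbors e).

Lemma adj_sym x y : e x y = e y x.
Proof. by case: srg => -[+ _] _ _ _ _; apply. Qed.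

Lemma adj_irr x : e x x = false.
Proof. by case: srg => -[_ +] _ _ _ _; apply. Qed.

Lemma adj_neq x y : e x y -> x != y.
Proof. by apply: contraTneq => ->; rewrite adj_irr. Qed.

Lemma card_common x y :
  #|N x :&: N y| = if x == y then 112 else if e x y then 1 else 20.
Proof.
case: srg => _ _ val adj nadj.
case: (eqVneq x y) => [<-|nxy]; first by rewrite setIid val.
by case: ifP => exy; [apply: adj | apply: nadj => //; rewrite exy].
Qed.

Lemma card_neighbors x : #|N x| = 112.
Proof. exact: srg_valency srg x. Qed.

Definition mate u a := odflt u [pick x in N u :&: N a].

Lemma mateP u a : e u a -> e u (mate u a) /\ e a (mate u a).
Proof.
move=> eua; rewrite /mate; case: pickP => [x|none].
  by rewrite !inE => /andP[].
have := card_common u a; rewrite (negPf (adj_neq eua)) eua.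
by rewrite (eq_card0 none).
Qed.

Lemma mate_uniq u a x : e u a -> e u x -> e a x -> x = mate u a.
Proof.
move=> eua eux eax; have [eum eam] := mateP eua.
have /eqP := card_common u a; rewrite (negPf (adj_neq eua)) eua.
case/cards1P=> z Nz.
have: x \in [set z] by rewrite -Nz !inE eux.
have: mate u a \in [set z] by rewrite -Nz !inE eum.
by rewrite !inE => /eqP-> /eqP.
Qed.

Lemma mateC u a : e u a -> mate u a = mate a u.
Proof.
move=> eua; have [eum eam] := mateP eua.
by apply: mate_uniq; rewrite // adj_sym.
Qed.

Lemma mateK u a : e u a -> mate u (mate u a) = a.
Proof.
move=> eua; have [eum eam] := mateP eua.
by apply/esym/mate_uniq; rewrite // adj_sym.
Qed.

Lemma mateKr u a : e u a -> mate a (mate u a) = u.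
Proof. by move=> eua; rewrite (mateC eua) mateK // adj_sym. Qed.

Lemma adj_local u x y : e u x -> e u y -> e x y = (y == mate u x).
Proof.
move=> eux euy; apply/idP/eqP => [exy|->]; first exact: mate_uniq.
by have [] := mateP eux.
Qed.

(** * The Euclidean representation on the eigenspace of -23 *)

Local Open Scope ring_scope.

(* With A the adjacency matrix, 108 I - 27 A + 4 J is 729 times the projection *)
(* onto the eigenspace of A for -23, of dimension 112.                         *)
Definition gram (x y : T) : int := 108 *+ (x == y) - 27 *+ e x y + 4.

Lemma gramC x y : gram x y = gram y x.
Proof. by rewrite /gram eq_sym adj_sym. Qed.

Lemma sum_pred1 (F : T -> int) x : \sum_y F y *+ (x == y) = F x.
Proof.
rewrite (bigD1 x) //= eqxx big1 ?addr0 // => y /negPf.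
by rewrite eq_sym => ->.
Qed.

Lemma sum_adj (F : T -> int) x : \sum_y F y *+ e x y = \sum_(y in N x) F y.
Proof. by rewrite [RHS]big_mkcond; apply: eq_bigr => y _; rewrite inE; case: (e x y). Qed.

Lemma gram_act (F : T -> int) x :
  \sum_y gram x y * F y = 108 * F x - 27 * (\sum_(y in N x) F y) + 4 * \sum_y F y.
Proof.
rewrite -{1}(sum_pred1 F x) -sum_adj !mulr_sumr -sumrB -big_split /=.
apply: eq_bigr => y _; rewrite /gram; case: (x == y); case: (e x y) => /=; ring.
Qed.

Lemma sum_mem (A : {set T}) (P : pred T) :
  \sum_(x in A) (P x : nat)%:R = (#|[set x in A | P x]|%:R : int).
Proof.
rewrite -sum1_card natr_sum [LHS]big_mkcond [RHS]big_mkcond /=.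
by apply: eq_bigr => x _; rewrite inE; case: (x \in A); case: (P x).
Qed.

Lemma sum_gram_adj x z :
  \sum_(y in N x) gram y z = 108 *+ e x z - 27 * #|N x :&: N z|%:R + 448.
Proof.
transitivity (\sum_(y in N x) (108 * (y == z : nat)%:R - 27 * (e y z : nat)%:R + 4) : int).
  by apply: eq_bigr => y _; rewrite /gram; case: (y == z); case: (e y z).
rewrite big_split sumrB -!mulr_sumr !sum_mem sumr_const card_neighbors /=.
have -> : [set y in N x | e y z] = N x :&: N z.
  by apply/setP=> y; rewrite !inE (adj_sym y).
have -> : #|[set y in N x | y == z]| = e x z.
  case exz: (e x z); last first.
    by apply: eq_card0 => y; rewrite !inE; case: eqP => [->|]; rewrite ?exz ?andbF.
  transitivity #|[set z]|; last by rewrite cards1.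
  apply: eq_card => y; rewrite !inE.
  by case: eqP => [->|]; rewrite ?exz ?andbF.
by case: (e x z); rewrite -mulr_natr; ring.
Qed.

Lemma sum_gram z : \sum_y gram y z = 0.
Proof.
have := gram_act (fun=> 1) z.
rewrite (eq_bigr (fun y => gram y z)); last by move=> y _; rewrite mulr1 gramC.
by move=> ->; rewrite !sumr_const card_neighbors; have [_ -> _ _ _] := srg.
Qed.

Lemma gram_sq x z : \sum_y gram x y * gram y z = 729 * gram x z.
Proof.
rewrite gram_act sum_gram sum_gram_adj card_common /gram.
case: (eqVneq x z) => [<-|_]; first by rewrite adj_irr.
by case: (e x z).
Qed.

(** As [gram] squares to 729 [gram], the sum of the squares of the inner products [g] is 729 times
    the norm of [r]. *)
Lemma gram_null (r : T -> int) :
    \sum_x r x * (\sum_y gram x y * r y) = 0 ->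
  forall x, \sum_y gram x y * r y = 0.
Proof.
set g := fun x => \sum_y gram x y * r y => r0 x; rewrite -/(g x).
have gg y : \sum_x gram y x * g x = 729 * g y.
  under eq_bigr => z _ do rewrite mulr_sumr.
  rewrite exchange_big mulr_sumr; apply: eq_bigr => z _ /=.
  by under eq_bigr => ? _ do rewrite mulrA; rewrite -mulr_suml gram_sq mulrA.
have sq0 : \sum_x g x ^+ 2 = 0.
  transitivity (\sum_x \sum_y g x * (gram x y * r y)).
    by apply: eq_bigr => z _; rewrite -mulr_sumr expr2.
  rewrite exchange_big (eq_bigr (fun y => 729 * (r y * g y))) /=.
    by rewrite -mulr_sumr r0 mulr0.
  move=> y _; rewrite mulrCA -gg mulr_sumr.
  by apply: eq_bigr => z _; rewrite gramC; ring.
apply/eqP; rewrite -sqrf_eq0; apply/eqP.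
by apply: (psumr_eq0P _ sq0) => // y _; apply: sqr_ge0.
Qed.

Definition far u w := [set x in N u | e (mate u x) w].

Section NonadjacentPair.

Variables u w : T.
Hypotheses (uw : u != w) (nuw : ~~ e u w).

Local Notation C := (N u :&: N w).
Local Notation C' := (far u w).

Lemma mate_near x : e u x -> (mate u x \in C) = (x \in C').
Proof.
move=> eux; have [eum _] := mateP eux.
by rewrite !inE eux eum (adj_sym w).
Qed.

Lemma mate_far x : e u x -> (mate u x \in C') = (x \in C).
Proof.
move=> eux; have [eum _] := mateP eux.
by rewrite !inE eux eum mateK // (adj_sym w).
Qed.

(** The edge from [x] to its mate has [u] as its only common neighbour, so [w] cannot be another
    one. *)
Lemma near_far_disjoint x : x \in C -> x \in C' -> False.
Proof.
rewrite !inE => /andP[eux ewx] /andP[_ emw].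
have [eum exm] := mateP eux.
have wE := mate_uniq exm (etrans (adj_sym x w) ewx) emw.
by case/eqP: uw; rewrite wE mateKr.
Qed.

Lemma card_near : #|C| = 20.
Proof. by rewrite card_common (negPf uw) (negPf nuw). Qed.

Lemma far_mate : C' = mate u @: C.
Proof.
apply/setP=> x; apply/idP/imsetP => [xC'|[y yC ->]].
  have eux: e u x by move: xC'; rewrite !inE => /andP[].
  by exists (mate u x); rewrite ?mate_near ?mateK.
by rewrite mate_far //; move: yC; rewrite !inE => /andP[].
Qed.

Lemma card_far : #|C'| = 20.
Proof.
rewrite far_mate card_in_imset ?card_near // => x y.
rewrite !inE => /andP[eux _] /andP[euy _] /(congr1 (mate u)).
by rewrite !mateK.
Qed.

Lemma card_local (A : {set T}) z :
  A \subset N u -> e u z -> #|A :&: N z| = (mate u z \in A).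
Proof.
move=> sA euz; case: (boolP (mate u z \in A)) => mA; last first.
  apply: eq_card0 => y; rewrite !inE; apply: contraNF mA => /andP[yA].
  have := subsetP sA y yA; rewrite inE => euy.
  by rewrite (adj_local euz euy) => /eqP<-.
transitivity #|[set mate u z]|; last by rewrite cards1.
apply: eq_card => y; rewrite !inE; case: (boolP (y \in A)) => /= yA.
  by have := subsetP sA y yA; rewrite inE => euy; rewrite (adj_local euz euy).
by apply/esym; apply: contraNF yA => /eqP->.
Qed.

Definition weight (a b c d : int) x : int :=
  a *+ (w == x) + b *+ (u == x) + c *+ (x \in C) + d *+ (x \in C').

Lemma sum_indicator (A B : {set T}) (c : int) :
  \sum_(y in A) c *+ (y \in B) = c * #|B :&: A|%:R.
Proof.
under eq_bigr => y _ do rewrite -mulr_natr.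
rewrite -mulr_sumr sum_mem; congr (_ * _%:R).
by apply: eq_card => y; rewrite !inE andbC.
Qed.

Lemma sum_point (A : {set T}) (c : int) y0 :
  \sum_(y in A) c *+ (y0 == y) = c *+ (y0 \in A).
Proof.
rewrite big_mkcond (bigD1 y0) //= big1 ?addr0; last first.
  by move=> y /negPf; rewrite eq_sym => ->; case: ifP.
by rewrite eqxx; case: ifP.
Qed.

Lemma gram_weight a b c d z :
  \sum_y gram z y * weight a b c d y =
  108 * weight a b c d z
  - 27 * (a *+ e z w + b *+ e z u + c * #|C :&: N z|%:R + d * #|C' :&: N z|%:R)
  + 4 * (a + b + 20 * c + 20 * d).
Proof.
have sumN (A : {set T}) : \sum_(y in A) weight a b c d y =
    a *+ (w \in A) + b *+ (u \in A) + c * #|C :&: A|%:R + d * #|C' :&: A|%:R.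
  by rewrite !big_split /= !sum_point !sum_indicator.
have sumT : \sum_y weight a b c d y = a + b + 20 * c + 20 * d.
  transitivity (\sum_(y in [set: T]) weight a b c d y).
    by apply: eq_bigl => y; rewrite inE.
  by rewrite sumN !inE !setIT card_near card_far /= !mulr1n; ring.
by rewrite gram_act sumN sumT !inE.
Qed.

(* Euclidean form of the relation: in the 112-dimensional representation of *)
(* the graph, x_w is an explicit combination of the vectors x_u and x_a for *)
(* a adjacent to u.                                                        *)
Lemma gram_relation z : \sum_y gram z y * weight 15 20 4 1 y = 0.
Proof.
apply: gram_null => {z}; apply: big1 => z _; rewrite gram_weight /weight.
have subC : C \subset N u by apply: subsetIl.
have subC' : C' \subset N u by apply/subsetP=> x; rewrite !inE => /andP[].
have ewu : e w u = false by rewrite adj_sym (negPf nuw).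
case: (eqVneq w z) => [<-|_].
  rewrite adj_irr ewu.
  have -> : C :&: N w = C by apply/setIidPl/subsetIr.
  have -> : C' :&: N w = set0.
    apply/setP=> x; rewrite [RHS]inE; apply/negP => /setIP[xC'].
    rewrite inE => ewx; apply: (@near_far_disjoint x) => //.
    by move: xC'; rewrite !inE => /andP[-> _].
  rewrite card_near cards0 (negPf uw).
  have -> : w \in C = false by rewrite !inE (negPf nuw).
  by have -> : w \in C' = false by rewrite !inE (negPf nuw).
case: (eqVneq u z) => [<-|_].
  rewrite adj_irr (negPf nuw).
  have -> : C :&: N u = C by apply/setIidPl.
  have -> : C' :&: N u = C' by apply/setIidPl.
  rewrite card_near card_far.
  have -> : u \in C = false by rewrite !inE adj_irr.
  by have -> : u \in C' = false by rewrite !inE adj_irr.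
case: (boolP (e u z)) => euz; last first.
  have -> : z \in C = false by rewrite !inE (negPf euz).
  have -> : z \in C' = false by rewrite !inE (negPf euz).
  by rewrite !mulr0n !addr0 mul0r.
rewrite !card_local // mate_near // mate_far // (adj_sym z u) euz.
case: (boolP (z \in C)) => zC.
  have -> : z \in C' = false by apply/negP; apply: near_far_disjoint.
  by move: zC; rewrite !inE euz (adj_sym w) /= => ->.
case: (boolP (z \in C')) => zC'; last by rewrite !mulr0n !addr0 mul0r.
by move: zC; rewrite !inE euz (adj_sym w) /= => /negPf->.
Qed.

(** This is [gram_relation] evaluated at [z] and divided by 27. *)
Lemma relation_count z :
  (4 * #|C :&: N z| + #|C' :&: N z| + 15 * e z w + 20 * e z u
   = 20 + 60 * (w == z) + 80 * (u == z) + 16 * (z \in C) + 4 * (z \in C'))%N.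
Proof.
have := gram_relation z; rewrite gram_weight /weight.
exact: relation_arith.
Qed.

End NonadjacentPair.

Lemma sum_gram_neighbors p z : \sum_(v in N p) gram v z = - 23 * gram p z.
Proof.
rewrite sum_gram_adj card_common /gram; case: (eqVneq p z) => [<-|_].
  by rewrite adj_irr.
by case: (e p z).
Qed.

(** The neighbours of [p] act as a frame of the eigenspace: up to the term in [p], the dual of x_v
    is 4 x_v plus its mate. For [x] equal or adjacent to [p] this is a direct computation; otherwise
    [gram_relation] for [p] and [x] supplies the sum over common neighbours and their mates. *)
Lemma gram_local p x z :
  \sum_(v in N p) (4 * gram x v + gram x (mate p v)) * gram v z =
  405 * gram x z + 20 * gram x p * gram p z.
Proof.
have [<-|px] := eqVneq p x.
  transitivity (\sum_(v in N p) (- 115) * gram v z).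
    apply: eq_bigr => v; rewrite inE => epv; have [epm _] := mateP epv.
    by rewrite /gram epv epm (negPf (adj_neq epv)) (negPf (adj_neq epm)).
  have -> : gram p p = 112 by rewrite /gram eqxx adj_irr.
  by rewrite -mulr_sumr sum_gram_neighbors; ring.
have [epx|npx] := boolP (e p x).
  transitivity (\sum_(v in N p) (405 * gram v z *+ (x == v) + 20 * gram v z)).
    apply: eq_bigr => v; rewrite inE => epv; have [epm evm] := mateP epv.
    rewrite /gram (adj_local epx epv) (adj_local epx epm).
    have [E|nxv] := eqVneq x v.
      subst v; rewrite (negPf (adj_neq evm)) eqxx /=.
      by case: (x == z); case: (e x z); ring.
    have -> : (mate p v == mate p x) = false.
      by apply: contraNF nxv => /eqP/(congr1 (mate p)); rewrite !mateK // => ->.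
    have -> : (x == mate p v) = (v == mate p x).
      by apply/eqP/eqP => ->; rewrite mateK.
    by case: (v == mate p x); case: (v == z); case: (e v z).
  rewrite big_split -mulr_sumr sum_gram_neighbors /=.
  rewrite (bigD1 x) ?inE //= eqxx big1 ?addr0 => [|v /andP[_ /negPf]]; last first.
    by rewrite eq_sym => ->.
  have -> : gram x p = -23 by rewrite gramC /gram (negPf px) epx.
  by rewrite mulr1n; ring.
have /eqP := gram_relation px npx z.
have -> : \sum_y gram z y * weight p x 15 20 4 1 y = 15 * gram x z + 20 * gram p z
   + \sum_(v in N p) (4 *+ (e x v) + 1 *+ e x (mate p v)) * gram v z.
  have pt (c : int) y0 : \sum_y gram z y * (c *+ (y0 == y)) = c * gram y0 z.
    rewrite (bigD1 y0) //= big1 ?addr0 => [|y /negPf]; last first.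
      by rewrite eq_sym => ->; rewrite mulr0.
    by rewrite eqxx mulrC gramC.
  have -> : \sum_(v in N p) (4 *+ (e x v) + 1 *+ e x (mate p v)) * gram v z
    = \sum_y gram z y * (4 *+ (y \in N p :&: N x) + 1 *+ (y \in far p x)).
    rewrite big_mkcond; apply: eq_bigr => v _; rewrite !inE (adj_sym x (mate _ _)).
    case: (e p v); first by rewrite mulrC gramC.
    by rewrite !mulr0n addr0 mulr0.
  rewrite -!pt -!big_split; apply: eq_bigr => y _ /=.
  by rewrite /weight !mulrDr !addrA.
rewrite addr_eq0 => /eqP rel.
transitivity (\sum_(v in N p) (20 * gram v z
    - 27 * ((4 *+ (e x v) + 1 *+ e x (mate p v)) * gram v z))).
  apply: eq_bigr => v; rewrite inE => epv; have [epm _] := mateP epv.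
  rewrite {1 2}/gram.
  have -> : (x == v) = false by apply: contraNF npx => /eqP->.
  have -> : (x == mate p v) = false by apply: contraNF npx => /eqP->.
  by case: (e x v); case: (e x (mate p v)); rewrite ?mulr0n ?mulr1n; ring.
rewrite sumrB -!mulr_sumr sum_gram_neighbors.
have -> : gram x p = 4 by rewrite gramC /gram (negPf px) (negPf npx).
by move/eqP: rel; rewrite -eqr_oppLR => /eqP<-; ring.
Qed.

Lemma norm_local (r : T -> int) p :
  let f z := \sum_x r x * gram x z in
  \sum_(v in N p) (4 * f v + f (mate p v)) * f v =
  405 * (\sum_x r x * f x) + 20 * f p ^+ 2.
Proof.
move=> f.
have fC z : f z = \sum_x gram z x * r x.
  by apply: eq_bigr => x _; rewrite gramC mulrC.
transitivity (\sum_x r x * \sum_z (\sum_(v in N p)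
    (4 * gram x v + gram x (mate p v)) * gram v z) * r z).
  transitivity (\sum_(v in N p) \sum_x
      r x * ((4 * gram x v + gram x (mate p v)) * f v)).
    apply: eq_bigr => v _; rewrite {1 2}/f mulr_sumr -big_split mulr_suml /=.
    by apply: eq_bigr => x _; ring.
  rewrite exchange_big; apply: eq_bigr => x _; rewrite -mulr_sumr; congr (_ * _).
  under [RHS]eq_bigr => z _ do rewrite mulr_suml.
  rewrite exchange_big; apply: eq_bigr => v _ /=.
  by rewrite fC mulr_sumr; apply: eq_bigr => z _; rewrite mulrA.
transitivity (\sum_x (405 * (r x * f x) + 20 * f p * (r x * gram x p))).
  apply: eq_bigr => x _; under eq_bigr => z _ do rewrite gram_local mulrDl.
  rewrite big_split mulrDr /= !fC; congr (_ + _).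
    by rewrite !mulr_sumr; apply: eq_bigr => z _; ring.
  by rewrite !mulr_sumr mulr_suml; apply: eq_bigr => z _; ring.
by rewrite big_split -!mulr_sumr /= -/(f p) expr2 mulrA.
Qed.

Lemma sum_weight u w a b c d (F : T -> int) :
  \sum_x weight u w a b c d x * F x =
  a * F w + b * F u + c * (\sum_(x in N u :&: N w) F x)
  + d * (\sum_(x in far u w) F x).
Proof.
have pt (k : int) y0 : \sum_x (k *+ (y0 == x)) * F x = k * F y0.
  rewrite (bigD1 y0) //= eqxx big1 ?addr0 ?mulr1n // => x /negPf.
  by rewrite eq_sym => ->; rewrite mul0r.
have inA (k : int) (A : {set T}) :
    \sum_x (k *+ (x \in A)) * F x = k * \sum_(x in A) F x.
  rewrite mulr_sumr [RHS]big_mkcond; apply: eq_bigr => x _.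
  by case: (x \in A); rewrite ?mulr1n ?mulr0n ?mul0r.
rewrite -!pt -!inA -!big_split; apply: eq_bigr => x _ /=.
by rewrite /weight !mulrDl.
Qed.

(* With [y] the image of [x_w] under the linear map exchanging mates around  *)
(* [u], and [4 + 27 m v] the inner product of [x_v] with [y], expanding the  *)
(* norm of [y] in the basis formed by the neighbours of a vertex [p] forces  *)
(* [m v = 4], i.e. [y = x_v], for some [v].                                  *)
Lemma opposite_exists u w : u != w -> ~~ e u w ->
  exists s, [/\ u != s, ~~ e u s & N u :&: N s = far u w].
Proof.
move=> uw nuw; set C := N u :&: N w; set C' := far u w.
have subC : C \subset N u by apply: subsetIl.
have subC' : C' \subset N u by apply/subsetP=> x; rewrite !inE => /andP[].
have disj x : x \in C -> x \in C' = false.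
  by move=> xC; apply/negP => /(near_far_disjoint uw xC).
have disj' x : x \in C' -> x \in C = false.
  by move=> xC'; apply/negP=> xC; move: xC'; rewrite disj.
have wu : w != u by rewrite eq_sym.
have nwu : ~~ e w u by rewrite adj_sym.
(* The vertex sought must be adjacent to all of [C'], so it is looked for among the neighbours of
   one element [p] of [C']. *)
have [p pC'] : exists p, p \in C' by apply/card_gt0P; rewrite card_far.
have eup : e u p by move/(subsetP subC'): pC'; rewrite inE.
have nwp : e w p = false by move: (disj' p pC'); rewrite !inE eup.
have np x : x \in C -> (x == u) = false /\ (x == w) = false.
  rewrite !inE => /andP[eux ewx].
  by split; apply/eqP=> xE; move: eux ewx; rewrite xE adj_irr.
have np' x : x \in C' -> (x == u) = false /\ (x == w) = false.
  move/(subsetP subC'); rewrite inE => eux.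
  by split; apply/eqP=> xE; move: eux; rewrite xE ?adj_irr ?(negPf nuw).
(* [r] represents -15 y: the relation writes -15 x_w with coefficients 20 on [u], 4 on [C] and 1 on
   [C'], and exchanging mates swaps the last two. Hence [f z] is -15 (4 + 27 m), and the norm of [r]
   is 225 times 112. *)
pose r := weight u w 0 20 1 4; pose f z := \sum_x r x * gram x z.
have fE z : f z = 108 * r z
    - 27 * (20 *+ e z u + #|C :&: N z|%:R + 4 * #|C' :&: N z|%:R) + 480.
  transitivity (\sum_x gram z x * r x).
    by apply: eq_bigr => x _; rewrite gramC mulrC.
  by rewrite gram_weight // mul0rn add0r mul1r.
have fu : f u = - 60.
  rewrite fE /r /weight adj_irr eqxx !inE adj_irr /=.
  have -> : C :&: N u = C by apply/setIidPl.
  have -> : C' :&: N u = C' by apply/setIidPl.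
  by rewrite card_near // card_far // mul0rn.
have fw : f w = - 60.
  rewrite fE /r /weight !inE (adj_sym w) (negPf nuw) (negPf uw) /=.
  have -> : C :&: N w = C by apply/setIidPl/subsetIr.
  have -> : C' :&: N w = set0.
    apply/setP=> x; rewrite [RHS]inE; apply/negP => /setIP[xC' xw].
    by move: (disj' x xC'); rewrite inE xw (subsetP subC').
  by rewrite card_near // cards0 mul0rn.
have fC x : x \in C -> f x = - 60.
  move=> xC; have eux : e u x by move/(subsetP subC): xC; rewrite inE.
  have [xu xw] := np x xC.
  rewrite fE /r /weight eq_sym xw eq_sym xu xC (disj x xC) adj_sym eux.
  by rewrite (card_local subC) // (card_local subC') // mate_near // mate_far // xC (disj x xC).
have fC' x : x \in C' -> f x = 345.
  move=> xC'; have eux : e u x by move/(subsetP subC'): xC'; rewrite inE.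
  have [xu xw] := np' x xC'.
  rewrite fE /r /weight eq_sym xw eq_sym xu xC' (disj' x xC') adj_sym eux.
  by rewrite (card_local subC) // (card_local subC') // mate_near // mate_far // xC' (disj' x xC').
have norm_r : \sum_x r x * f x = 225 * 112.
  rewrite sum_weight fu (eq_bigr _ fC) (eq_bigr _ fC') !sumr_const.
  by rewrite (card_near uw nuw) (card_far uw nuw); clear; lia.
(* The neighbours of [p] where [m] is negative will be found in this set, which bounds their number
   by 1. *)
have bad_card : #|far w u :&: N p| = 1%N.
  have := relation_count wu nwu p.
  have -> : N w :&: N u :&: N p = C :&: N p by rewrite (setIC (N w)).
  rewrite (card_local subC) // mate_near // pC' (adj_sym p u) eup (adj_sym p w) nwp.
  have [pu pw] := np' p pC'.
  by rewrite eq_sym pu eq_sym pw !inE nwp; move: #|_| => n; clear; lia.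
pose m v : int := ((- 60 - f v) %/ 405)%Z.
have mI v k : f v = - 60 - 405 * k -> m v = k.
  by rewrite /m => ->; clear; lia.
have mN v : v \in N p -> [/\ f v = - 60 - 405 * m v, -1 <= m v <= 4,
    m v < 0 -> v \in far w u
  & m v = 4 -> [/\ u != v, ~~ e u v & #|C' :&: N v| = 20%N]].
  rewrite inE => epv.
  have [<-|uv] := eqVneq u v; first by rewrite (mI u 0 fu) fu.
  have wv : w != v by apply: contraFneq nwp => ->; rewrite adj_sym.
  have [euv|nuv] := boolP (e u v).
    have vE : v = mate u p by apply: mate_uniq.
    have vC : v \in C by rewrite vE mate_near.
    by rewrite (mI v 0 (fC v vC)) (fC v vC).
  have cnt := relation_count uw nuw v.
  have fv := fE v; rewrite /r /weight in fv; move: cnt fv.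
  have -> : v \in C = false by rewrite inE inE (negPf nuv).
  have -> : v \in C' = false by rewrite inE inE (negPf nuv).
  have c'_gt0 : (0 < #|C' :&: N v|)%N.
    by apply/card_gt0P; exists p; rewrite inE pC' inE adj_sym.
  rewrite (negPf uv) (negPf wv) (adj_sym v u) (negPf nuv) (adj_sym v w).
  rewrite -/C -/C'; move: c'_gt0.
  have far_wu : e w v -> #|C :&: N v| = 1%N -> v \in far w u.
    move=> ewv /eqP/cards1P[a aE].
    have : a \in C :&: N v by rewrite aE inE.
    rewrite !inE => /andP[/andP[eua ewa] eva].
    by rewrite ewv -(mate_uniq ewv ewa eva) adj_sym.
  move: far_wu; move: #|C :&: N v| #|C' :&: N v| => c c' far_wu c'0.
  case: (boolP (e w v)) far_wu => ewv far_wu cnt fv; last first.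
    have fm : f v = - 60 - 405 * (4 - c%:Z) by rewrite fv; move: cnt; clear; lia.
    rewrite (mI _ _ fm) {1}fm; split=> //; first by move: cnt c'0; clear; lia.
      by move: cnt c'0; clear; lia.
    by move=> m4; split=> //; move: cnt m4; clear; lia.
  have [c1|nc1] := eqVneq c 1%N.
    have fm : f v = - 60 - 405 * (- 1).
      by rewrite fv; move: cnt; rewrite c1; clear; lia.
    by rewrite (mI _ _ fm) {1}fm; split=> // _; apply: far_wu.
  have fm : f v = - 60 - 405 * 0 by rewrite fv; move: cnt nc1; clear; lia.
  by rewrite (mI _ _ fm) {1}fm; split.
have fp := fC' p pC'.
have mates v : v \in N p -> mate p v \in N p.
  by rewrite !inE => epv; have [] := mateP epv.
have sum_mate (F : T -> int) : \sum_(v in N p) F (mate p v) = \sum_(v in N p) F v.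
  have mm : mate p @: N p = N p.
    apply/setP=> v; apply/imsetP/idP => [[x xN ->]|vN]; first exact: mates.
    by exists (mate p v); [apply: mates | rewrite mateK //; move: vN; rewrite inE].
  rewrite -[in RHS]mm big_imset // => x y; rewrite !inE => epx epy.
  by move/(congr1 (mate p)); rewrite !mateK.
have sum_f : \sum_(v in N p) f v = - 23 * 345.
  rewrite exchange_big (eq_bigr (fun x => - 23 * (r x * gram x p))).
    by rewrite -mulr_sumr -/(f p) fp.
  move=> x _; rewrite -mulr_sumr (eq_bigr (fun v => gram v x)).
    by rewrite sum_gram_neighbors gramC; ring.
  by move=> v _; rewrite gramC.
have sum_m : \sum_(v in N p) m v = 3.
  have : \sum_(v in N p) (- 60 - 405 * m v) = - 23 * 345.
    by rewrite -sum_f; apply: eq_bigr => v /mN[<-].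
  rewrite sumrB sumr_const card_neighbors -mulr_sumr.
  by move: (\sum_(v in N p) m v) => S; clear; lia.
have sum_m2 : \sum_(v in N p) (4 * m v ^+ 2 + m v * m (mate p v)) = 60.
  have := norm_local r p; rewrite /= norm_r -/(f p) fp.
  rewrite (eq_bigr (fun v => 300 * 60 + 405 * 540 * m v + 405 * 60 * m (mate p v)
     + 405 * 405 * (4 * m v ^+ 2 + m v * m (mate p v)))); last first.
    move=> v vN; rewrite -!/(f _); have [-> _ _ _] := mN v vN.
    by have [-> _ _ _] := mN _ (mates v vN); ring.
  have split4 (c1 c2 c3 c4 : int) (q : T -> int) :
      \sum_(v in N p) (c1 + c2 * m v + c3 * m (mate p v) + c4 * q v) =
      c1 *+ 112 + c2 * 3 + c3 * 3 + c4 * \sum_(v in N p) q v.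
    rewrite !big_split -!mulr_sumr (sum_mate m) sum_m sumr_const.
    by rewrite card_neighbors.
  rewrite split4.
  by move: (\sum_(v in N p) _ ) => S; clear; lia.
have [v vN m4] : exists2 v, v \in N p & m v = 4.
  apply: (paired_values (i := mate p) _ _ _ sum_m sum_m2).
  - move=> v vN; have epv : e p v by move: vN; rewrite inE.
    have [epm evm] := mateP epv; split; [exact: mates| |exact: mateK].
    by rewrite eq_sym adj_neq.
  - by move=> v /mN[].
  rewrite -bad_card; apply/subset_leq_card/subsetP=> v.
  by rewrite inE => /andP[vN m0]; rewrite inE vN andbT; have [_ _ ->] := mN v vN.
have [_ _ _ /(_ m4)[uv nuv c'20]] := mN v vN.
exists v; split=> //; apply/eqP; rewrite eq_sym eqEcard.
rewrite card_near // card_far // leqnn andbT subsetI subC' /=.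
have : C' :&: N v == C' by rewrite eqEcard subsetIl card_far // c'20.
by move/eqP <-; apply: subsetIr.
Qed.

(* Reflections of the graph *)
Local Close Scope ring_scope.

(** Evaluating [relation_count] for [u], [s] at [t] gives at least 80 on the left, and 20 on the
    right unless [s = t]. *)
Lemma near_inj u s t : u != s -> ~~ e u s -> u != t -> ~~ e u t ->
  N u :&: N s = N u :&: N t -> s = t.
Proof.
move=> us nus ut nut near; apply/eqP; have := relation_count us nus t.
rewrite {1}near.
have -> : N u :&: N t :&: N t = N u :&: N t by rewrite -setIA setIid.
rewrite card_near // (negPf ut) !inE (negPf nut).
by case: (s == t) => //; move: #|_| (nat_of_bool (e t s)) (nat_of_bool (e t u)); clear; lia.
Qed.

Lemma far_far u w s : N u :&: N s = far u w -> far u s = N u :&: N w.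
Proof.
move=> nearE; apply/setP=> x; rewrite !inE; case eux: (e u x) => //=.
have [eum _] := mateP eux; rewrite adj_sym (adj_sym w).
have: mate u x \in N u :&: N s = (mate u x \in far u w) by rewrite nearE.
by rewrite !inE eum mateK.
Qed.

(** The reflection of [w] in [u]. In the vector space model it is -(u + w), the third point of the
    affine line through [u] and [w], which explains its symmetry in both arguments. *)
Definition opp u w :=
  if u == w then u else if e u w then mate u w else
  odflt u [pick s | [&& u != s, ~~ e u s & N u :&: N s == far u w]].

Lemma opp_id u : opp u u = u.
Proof. by rewrite /opp eqxx. Qed.

Lemma opp_mate u w : e u w -> opp u w = mate u w.
Proof. by move=> euw; rewrite /opp (negPf (adj_neq euw)) euw. Qed.

Lemma oppP u w : u != w -> ~~ e u w ->
  [/\ u != opp u w, ~~ e u (opp u w) & N u :&: N (opp u w) = far u w].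
Proof.
move=> uw nuw; rewrite /opp (negPf uw) (negPf nuw).
case: pickP => [s /and3P[us nus /eqP]|none] //.
have [s [us nus nearE]] := opposite_exists uw nuw.
by have := none s; rewrite us nus nearE eqxx.
Qed.

Lemma opp_adj_base u w : e u (opp u w) = e u w.
Proof.
have [<-|uw] := eqVneq u w; first by rewrite opp_id.
have [euw|nuw] := boolP (e u w).
  by rewrite opp_mate //; have [] := mateP euw.
by have [_ /negPf] := oppP uw nuw.
Qed.

Lemma oppK u : involutive (opp u).
Proof.
move=> w; have [<-|uw] := eqVneq u w; first by rewrite !opp_id.
have [euw|nuw] := boolP (e u w).
  by rewrite (opp_mate euw) opp_mate ?mateK //; have [] := mateP euw.
have [us nus nearE] := oppP uw nuw; have [ut nut nearE'] := oppP us nus.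
by apply: (@near_inj u) => //; rewrite nearE' (far_far nearE).
Qed.

Lemma card_mate u (A B : {set T}) : A \subset N u -> B \subset N u ->
  (forall x, e u x -> (mate u x \in B) = (x \in A)) -> #|A| = #|B|.
Proof.
move=> /subsetP sA /subsetP sB AB; rewrite -(card_in_imset (f := mate u)); last first.
  move=> x y /sA + /sA; rewrite !inE => eux euy /(congr1 (mate u)).
  by rewrite !mateK.
apply: eq_card => y; apply/imsetP/idP => [[x xA ->]|yB].
  by have := sA x xA; rewrite inE => /AB->.
have := sB y yB; rewrite inE => euy; have [eum _] := mateP euy.
by exists (mate u y); rewrite ?mateK // -AB // mateK.
Qed.

(** When neither vertex is adjacent to [u], adjacency of [x] and [y] can be read from
    [relation_count] through the sizes of intersections inside [N u]. The exchange of mates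
    preserves these sizes, so both pairs satisfy the same equation. *)
Lemma opp_adj u x y : e (opp u x) (opp u y) = e x y.
Proof.
have [<-|ux] := eqVneq u x; first by rewrite opp_id opp_adj_base.
have [<-|uy] := eqVneq u y.
  by rewrite opp_id adj_sym opp_adj_base adj_sym.
wlog eux : x y ux uy / e u x \/ ~~ e u x && ~~ e u y.
  have [eux|nux] := boolP (e u x); first by apply=> //; left.
  have [euy|nuy] := boolP (e u y); last by apply=> //; rewrite nux nuy; right.
  by move=> sym; rewrite adj_sym [RHS]adj_sym; apply: sym => //; left.
have [->|xy] := eqVneq x y; first by rewrite !adj_irr.
case: eux => [eux|/andP[nux nuy]].
  have [eum _] := mateP eux; rewrite (opp_mate eux).
  have [euy|nuy] := boolP (e u y).
    have [eum' _] := mateP euy; rewrite (opp_mate euy).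
    rewrite (adj_local eum eum') (adj_local eux euy) mateK //.
    by apply/eqP/eqP => [<-|->]; rewrite mateK.
  have [_ _ /setP/(_ (mate u x))] := oppP uy nuy.
  by rewrite !inE eum mateK //= (adj_sym (opp u y)).
have [us nus nearE] := oppP ux nux; have [ut nut nearE'] := oppP uy nuy.
have st : opp u x != opp u y by rewrite (can_eq (oppK u)).
have := relation_count ux nux y; have := relation_count us nus (opp u y).
rewrite !inE (negPf nuy) (negPf nut) (negPf uy) (negPf ut) (negPf xy) (negPf st).
rewrite !(adj_sym _ u) (negPf nuy) (negPf nut) (adj_sym y x) (adj_sym (opp u y)).
have localI (A B : {set T}) : A \subset N u -> A :&: B = A :&: (N u :&: B).
  by move=> sA; rewrite setIA (setIidPl sA).
have sC z : N u :&: N z \subset N u by apply: subsetIl.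
have sC' z : far u z \subset N u by apply/subsetP=> z'; rewrite !inE => /andP[].
rewrite (localI _ (N y) (sC x)) (localI _ (N y) (sC' x)).
rewrite (localI _ (N (opp u y)) (sC (opp u x))) (localI _ (N (opp u y)) (sC' (opp u x))).
rewrite nearE nearE' (far_far nearE).
have -> : #|far u x :&: far u y| = #|N u :&: N x :&: (N u :&: N y)|.
  apply: (@card_mate u); rewrite ?(subset_trans (subsetIl _ _)) // => z euz.
  by rewrite in_setI [RHS]in_setI !mate_near.
have -> : #|N u :&: N x :&: far u y| = #|far u x :&: (N u :&: N y)|.
  apply: (@card_mate u); rewrite ?(subset_trans (subsetIl _ _)) // => z euz.
  by rewrite in_setI [RHS]in_setI mate_far // mate_near.
move: #|_| #|_| => p q; case: (e x y); case: (e _ _) => //; clear; lia.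
Qed.

(** A description of [opp u w] in terms of adjacency alone, and symmetric in [u] and [w]: it gives
    both [oppC] and the invariance [opp_morph] under automorphisms. *)
Definition antipodal u w s :=
  [/\ u != w, ~~ e u w, u != s & ~~ e u s] /\ ~~ e w s /\ N u :&: N w :&: N s = set0.

Lemma opp_antipodal u w : u != w -> ~~ e u w -> antipodal u w (opp u w).
Proof.
move=> uw nuw; have [us nus nearE] := oppP uw nuw; split=> //.
have c0 : N u :&: N w :&: N (opp u w) = set0.
  apply/setP=> x; rewrite [RHS]inE; apply/negP => /setIP[xC xs].
  apply: (near_far_disjoint uw xC); rewrite -nearE inE xs andbT.
  by case/setIP: xC.
split=> //; have := relation_count uw nuw (opp u w); rewrite c0 cards0.
have -> : far u w :&: N (opp u w) = far u w by rewrite -nearE -setIA setIid.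
rewrite card_far // !inE (negPf us) (negPf nus) (adj_sym _ w) (adj_sym _ u) (negPf nus).
by case: (e w _) => //; case: (w == _).
Qed.

Lemma antipodal_opp u w s : antipodal u w s -> opp u w = s.
Proof.
case=> -[uw nuw us nus] [nws c0]; have [ut nut nearE] := oppP uw nuw.
apply: (near_inj ut nut us nus); rewrite nearE; apply/eqP; rewrite eqEcard.
rewrite card_far // card_near // leqnn andbT.
have := relation_count uw nuw s; rewrite c0 cards0 !inE (negPf us) (negPf nus).
rewrite (adj_sym s w) (adj_sym s u) (negPf nws) (negPf nus).
have /negPf-> : w != s.
  apply/eqP=> ws; move: (card_near uw nuw); rewrite -(setIid (N w)) setIA {2}ws c0.
  by rewrite cards0.
rewrite /= => c'20.
have : far u w :&: N s == far u w.
  by rewrite eqEcard subsetIl card_far //; move: c'20; clear; lia.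
move/eqP <-; rewrite subsetI subsetIr andbT (subset_trans (subsetIl _ _)) //.
by apply/subsetP=> x; rewrite !inE => /andP[].
Qed.

Lemma oppC u w : opp u w = opp w u.
Proof.
have [->|uw] := eqVneq u w => //.
have [euw|nuw] := boolP (e u w).
  by rewrite !opp_mate ?(adj_sym w) // mateC.
have [[_ _ us nus] [nws c0]] := opp_antipodal uw nuw.
have ws : w != opp u w.
  apply/eqP=> ws; move: (card_near uw nuw); rewrite -(setIid (N w)) setIA {2}ws c0.
  by rewrite cards0.
apply/esym/antipodal_opp; split; first by rewrite eq_sym adj_sym.
by split=> //; rewrite (setIC (N w)).
Qed.

Lemma opp_morph (f : T -> T) : bijective f -> (forall x y, e (f x) (f y) = e x y) ->
  forall x y, f (opp x y) = opp (f x) (f y).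
Proof.
move=> [g fK gK] fe x y; have finj := can_inj fK.
have [->|xy] := eqVneq x y; first by rewrite !opp_id.
have [exy|nxy] := boolP (e x y).
  have [exm eym] := mateP exy.
  by rewrite !opp_mate ?fe //; apply: mate_uniq; rewrite fe.
have [[_ _ xs nxs] [nys c0]] := opp_antipodal xy nxy.
apply/esym/antipodal_opp; split; first by rewrite !fe !(inj_eq finj).
split; first by rewrite fe.
apply/setP=> z; rewrite -(gK z) !inE !fe.
by move/setP/(_ (g z)): c0; rewrite !inE.
Qed.

Lemma opp_opp u x y : opp u (opp x y) = opp (opp u x) (opp u y).
Proof.
by apply: opp_morph; [exists (opp u); apply: oppK | apply: opp_adj].
Qed.

(** * Products of two reflections *)

Definition reflection u : {perm T} := perm (can_inj (oppK u)).

Lemma reflectionE u x : reflection u x = opp u x.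
Proof. by rewrite permE. Qed.

Lemma reflection_sq u : (reflection u * reflection u = 1)%g.
Proof. by apply/permP=> x; rewrite permM !reflectionE oppK perm1. Qed.

Lemma reflectionV u : ((reflection u)^-1 = reflection u)%g.
Proof. by apply/eqP; rewrite eq_invg_mul reflection_sq. Qed.

Lemma reflection_opp u x : (reflection (opp u x) = reflection u * reflection x * reflection u)%g.
Proof.
apply/permP=> y; rewrite !permM !reflectionE.
by rewrite opp_opp oppK.
Qed.

Definition tau a b : {perm T} := (reflection b * reflection a)%g.

Lemma tauE a b x : tau a b x = opp a (opp b x).
Proof. by rewrite permM !reflectionE. Qed.

(** Conjugating reflections, [oppC] becomes the braid relation aba = bab between the involutions a
    and b, that is (ba)^3 = 1. *)
Lemma tau_cube a b : (tau a b ^+ 3 = 1)%g.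
Proof.
have: reflection (opp a b) = reflection (opp b a) by rewrite oppC.
rewrite !reflection_opp !expgS expg0 mulg1 /tau => eq_ab.
by rewrite -!mulgA (mulgA (reflection a)) (mulgA _ (reflection a)) eq_ab !mulgA
  reflection_sq mul1g -(mulgA (reflection a)) reflection_sq mulg1 reflection_sq.
Qed.

Lemma tau_morph a b x y : e (tau a b x) (tau a b y) = e x y.
Proof. by rewrite !tauE !opp_adj. Qed.

(* With q = opp b x, one has x = opp q b and tau a b x = opp q a. *)
Lemma tau_adj a b x : e a b -> e x (tau a b x).
Proof.
move=> eab; rewrite tauE -{1}(oppK b x) (oppC b (opp b x)) (oppC a) opp_adj.
by rewrite adj_sym.
Qed.

Lemma tau_mate a b x : e a b -> mate x (tau a b x) = tau a b (tau a b x).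
Proof.
move=> eab; apply/esym/mate_uniq; rewrite ?tau_adj // adj_sym.
rewrite -[X in e _ X](_ : tau a b (tau a b (tau a b x)) = x) ?tau_adj //.
have := congr1 (fun g : {perm T} => g x) (tau_cube a b).
by rewrite !expgS expg0 mulg1 !permM perm1.
Qed.

(** The image n of [x] determines its triangle x, n, m, on which both maps agree. For another
    neighbour p of [x], the vertex t (t p) is the unique element of [far p n :&: N m], and t p is
    its mate around p. A vertex not adjacent to [x] is determined by its common neighbours with [x],
    through [near_inj]. *)
Lemma tau_inj a b c d x : e a b -> e c d ->
  tau a b x = tau c d x -> tau a b = tau c d.
Proof.
move=> eab ecd eqx; set t := tau a b in eqx *; set t' := tau c d in eqx *.
set n := t x; have exn : e x n by apply: tau_adj.
set m := mate x n; have [exm enm] := mateP exn.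
have tn : t n = m by rewrite /m /n tau_mate.
have t'n : t' n = m by rewrite /m /n eqx tau_mate.
have tm : t m = x.
  by rewrite -tn -(mateKr exn) -/n /n tau_mate ?tau_adj // tau_mate.
have t'm : t' m = x.
  by rewrite -t'n -(mateKr exn) -/n /n eqx tau_mate ?tau_adj // tau_mate.
have eqN p : e x p -> t p = t' p.
  move=> exp; have [->|pn] := eqVneq p n; first by rewrite tn t'n.
  have [->|pm] := eqVneq p m; first by rewrite tm t'm.
  have npn : ~~ e p n by rewrite adj_sym (adj_local exn exp).
  have nmp : e m p = false by rewrite (adj_local exm exp) mateK // (negPf pn).
  have c1 : #|N p :&: N n :&: N m| = 1.
    rewrite -setIA; have /eqP/cards1P[z zE] : #|N n :&: N m| = 1.
      by rewrite card_common (negPf (adj_neq enm)) enm.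
    have : x \in N n :&: N m by rewrite !inE adj_sym exn adj_sym exm.
    rewrite zE inE => /eqP <-; rewrite (setIidPr _) ?cards1 // sub1set inE.
    by rewrite adj_sym.
  (* [relation_count] for [p], [n] at [m]: the left side is 4 + 15 plus the unknown size, the right
     side is 20. *)
  have far1 : #|far p n :&: N m| = 1.
    have := relation_count pn npn m.
    rewrite c1 (adj_sym m n) enm nmp (negPf (adj_neq enm)) (negPf pm) !inE.
    by rewrite (adj_sym p m) nmp; move: #|_|; clear; lia.
  have tp r : (forall y z, e (r y) (r z) = e y z) -> mate p (r p) = r (r p) ->
      e p (r p) -> r x = n -> r n = m -> r (r p) \in far p n :&: N m.
    move=> rm rp epr rx rn; have [eprr _] := mateP epr.
    rewrite !inE -rp eprr mateK // -rx rm adj_sym exp /=.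
    by rewrite rp -rn -rx !rm.
  have [z zE] : exists z, far p n :&: N m = [set z] by apply/cards1P/eqP.
  have ttp : t (t p) \in far p n :&: N m.
    by apply: tp => //; rewrite ?tau_mate ?tau_adj //; apply: tau_morph.
  have ttp' : t' (t' p) \in far p n :&: N m.
    by apply: tp; rewrite ?tau_mate ?tau_adj //; apply: tau_morph.
  move: ttp ttp'; rewrite zE !inE => /eqP ttp /eqP ttp'.
  rewrite -(mateK (tau_adj p eab)) -/t tau_mate // -/t ttp.
  by rewrite -ttp' -[t' (t' p)]tau_mate // mateK // tau_adj.
apply/permP=> w; have [->|xw] := eqVneq w x; first by [].
have [exw|nxw] := boolP (e x w); first exact: eqN.
have tm_eq y z : e (t y) (t z) = e y z by apply: tau_morph.
have tm_eq' y z : e (t' y) (t' z) = e y z by apply: tau_morph.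
apply: (@near_inj n).
- by rewrite /n (inj_eq perm_inj) eq_sym.
- by rewrite /n tm_eq.
- by rewrite /n eqx (inj_eq perm_inj) eq_sym.
- by rewrite /n eqx tm_eq'.
apply/setP=> z; rewrite !inE; set z0 := (t^-1)%g z.
have zE : z = t z0 by rewrite permKV.
have -> : e n z = e x z0 by rewrite zE tm_eq.
case exz: (e x z0) => //=; rewrite [in RHS]zE (eqN z0 exz) tm_eq'.
by rewrite zE tm_eq.
Qed.

(* Any reflection turns tau a c into another reflection, hence inverts it. *)
Lemma tau_reflection a c b : e a c -> exists y, tau a c = tau b y.
Proof.
move=> eac; set x := ((tau a c)^-1)%g b.
have tx : tau a c x = b by rewrite permKV.
have exb : e x b by rewrite -tx tau_adj.
exists (opp x b); apply: (@tau_inj _ _ _ _ x) => //.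
  by rewrite (oppC x) opp_adj_base adj_sym.
by rewrite tx tauE (oppC (opp x b)) oppK opp_id.
Qed.

Lemma reflection_tau b a c : e a c -> (reflection b * tau a c * reflection b = (tau a c)^-1)%g.
Proof.
move=> /(tau_reflection b)[y ->].
by rewrite /tau invMg !reflectionV -!mulgA reflection_sq mulg1.
Qed.

(** Each of the two reflections composing [tau b d] inverts [tau a c], so their product centralizes
    it. *)
Lemma tau_commute a c b d : e a c -> commute (tau a c) (tau b d).
Proof.
move=> eac; have fix_tau : (tau a c ^ tau b d = tau a c)%g.
  transitivity (reflection b * (reflection d * tau a c * reflection d) * reflection b)%g.
    by rewrite conjgE {1 3}/tau invMg !reflectionV !mulgA.
  rewrite reflection_tau // -(reflection_tau b) //.
  by rewrite 2!mulgA (reflection_sq b) mul1g -mulgA (reflection_sq b) mulg1.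
by rewrite /commute conjgC fix_tau.
Qed.

(** * The translation group *)

Definition translation_set := [set tau p.1 p.2 | p : T * T & e p.1 p.2].

Definition translations : {group {perm T}} := <<translation_set>>%G.

Lemma translation_setP g :
  reflect (exists a b, e a b /\ g = tau a b) (g \in translation_set).
Proof.
apply: (iffP imsetP) => [[[a b]]|[a [b [eab ->]]]].
  by rewrite inE => /= eab ->; exists a, b.
by exists (a, b); rewrite ?inE.
Qed.

Lemma translations_abelian : abelian translations.
Proof.
rewrite abelian_gen; apply/centsP=> _ /translation_setP[a [b [eab ->]]].
by move=> _ /translation_setP[c [d [_ ->]]]; apply: tau_commute.
Qed.

Lemma translations_abelem : 3.-abelem%g translations.
Proof.
apply/abelemP => //; split; first exact: translations_abelian.
move=> x; have gL := group_Ldiv 3 translations_abelian.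
have: translations \subset Group gL.
  rewrite gen_subG; apply/subsetP=> g gS; apply/LdivP; split; first exact: mem_gen.
  by case/translation_setP: gS => a [b [_ ->]]; rewrite tau_cube.
by move/subsetP => sub /sub /LdivP[].
Qed.

Lemma translation_adj g x y : g \in translations -> e (g x) (g y) = e x y.
Proof.
case/gen_prodgP => n [c cS ->]; elim: n c cS x y => [|n IHn] c cS x y.
  by rewrite big_ord0 !perm1.
rewrite big_ord_recl !permM IHn //.
by have /translation_setP[a [b [_ ->]]] := cS ord0; rewrite tau_morph.
Qed.

Lemma translation_step x y : e x y -> exists2 g, g \in translations & g x = y.
Proof.
move=> exy; have [exm eym] := mateP exy; have emx : e (mate x y) x by rewrite adj_sym.
exists (tau (mate x y) x); last first.
  by rewrite tauE opp_id opp_mate // (mateC emx) mateK.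
by apply: mem_gen; apply/translation_setP; exists (mate x y), x.
Qed.

Lemma translation_trans x y : exists2 g, g \in translations & g x = y.
Proof.
have [->|xy] := eqVneq x y; first by exists 1%g; rewrite ?group1 ?perm1.
have [exy|nxy] := boolP (e x y); first exact: translation_step.
have [z] : exists z, z \in N x :&: N y by apply/card_gt0P; rewrite card_near.
rewrite !inE (adj_sym y) => /andP[/translation_step[g gS <-]].
move=> /translation_step[h hS <-]; exists (g * h)%g; rewrite ?permM //.
exact: groupM.
Qed.

(** In a transitive abelian permutation group, an element is determined by the image of one
    point. *)
Lemma translation_regular x g h :
  g \in translations -> h \in translations -> g x = h x -> g = h.
Proof.
move=> gS hS gh; apply/permP=> y; have [k kS <-] := translation_trans x y.
have /centsP cc := translations_abelian.
by rewrite -!permM (cc _ kS _ gS) (cc _ kS _ hS) !permM gh.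
Qed.

Lemma cayley_form : exists2 f : 'rV['F_3]_6 -> T, bijective f &
  forall u v w, e (f (u + w)%R) (f (v + w)%R) = e (f u) (f v).
Proof.
have /card_gt0P[x0 _] : 0 < #|T| by have [_ -> _ _ _] := srg.
have cardE : #|translations| = 729.
  have [_ <- _ _ _] := srg; rewrite -cardsT.
  rewrite -(card_in_imset (f := fun g : {perm T} => g x0) (D := translations)).
    apply: eq_card => y; rewrite inE; apply/imsetP.
    by have [g gS <-] := translation_trans x0 y; exists g.
  by move=> g h gS hS; apply: translation_regular.
have : translations \isog [set: 'rV['F_3]_6].
  by rewrite (isog_abelem_card _ translations_abelem) mx_Fp_abelem //= cardsT
    card_mx card_Fp // cardE.
case/isogP=> f injf imf.
have /fin_all_exists2[g gS gK] (v : 'rV['F_3]_6) :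
    exists2 x, x \in translations & f x = v.
  have: v \in (f @* translations)%g by rewrite imf inE.
  by case/morphimP=> x _ xS ->; exists x.
have gD u v : g (u + v)%R = (g u * g v)%g.
  by apply: (injmP injf); rewrite ?groupM // morphM // !gK.
exists (fun v => g v x0).
  apply: inj_card_bij => [u v /(translation_regular (gS u) (gS v)) guv|].
    by rewrite -(gK u) guv gK.
  by have [_ -> _ _ _] := srg; rewrite card_mx card_Fp.
by move=> u v w; rewrite !gD !permM translation_adj.
Qed.

End Graph.

(** * Hyperplane sections of the cap *)

Definition cayley n (C : {set 'rV['F_3]_n}) : rel 'rV['F_3]_n :=
  fun u v => (v - u)%R \in C.

Lemma srg_iso (T T' : finType) (e : rel T) (e' : rel T') v k l m (f : T' -> T) :
  bijective f -> (forall x y, e (f x) (f y) = e' x y) ->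
  strongly_regular v k l m e -> strongly_regular v k l m e'.
Proof.
move=> fbij fe [[sym irr] ord val adj nadj]; have finj := bij_inj fbij.
have [g fK gK] := fbij.
have cardN (A : {set T'}) (B : {set T}) :
    (forall x, (f x \in B) = (x \in A)) -> #|A| = #|B|.
  move=> AB; rewrite -(card_imset _ finj); apply: eq_card => y.
  by rewrite -(gK y) mem_imset // AB.
split.
- by split=> [x y|x]; rewrite -!fe ?irr // sym.
- by rewrite -ord; apply: bij_eq_card fbij.
- by move=> x; rewrite -(val (f x)); apply: cardN => y; rewrite !inE fe.
- move=> x y xy exy; rewrite -(adj (f x) (f y)) ?(inj_eq finj) ?fe //.
  by apply: cardN => z; rewrite !inE !fe.
- move=> x y xy exy; rewrite -(nadj (f x) (f y)) ?(inj_eq finj) ?fe //.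
  by apply: cardN => z; rewrite !inE !fe.
Qed.

Lemma F3_cases (a : 'F_3) : [\/ a = 0%R, a = 1%R | a = (-1)%R].
Proof. by case: a => -[|[|[|//]]] lt3; [constructor 1 | constructor 2 | constructor 3]; apply: val_inj. Qed.

Local Open Scope ring_scope.

Definition ev n (l : 'cV['F_3]_n) (v : 'rV['F_3]_n) : 'F_3 := (v *m l) 0 0.

Lemma evD n (l : 'cV['F_3]_n) u v : ev l (u + v) = ev l u + ev l v.
Proof. by rewrite /ev mulmxDl mxE. Qed.

Lemma evN n (l : 'cV['F_3]_n) v : ev l (- v) = - ev l v.
Proof. by rewrite /ev mulNmx mxE. Qed.

Lemma ev0 n (l : 'cV['F_3]_n) : ev l 0 = 0.
Proof. by rewrite /ev mul0mx mxE. Qed.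

Lemma ev_addl n (l m : 'cV['F_3]_n) v : ev (l + m) v = ev l v + ev m v.
Proof. by rewrite /ev mulmxDr mxE. Qed.

Lemma ev_oppl n (l : 'cV['F_3]_n) v : ev (- l) v = - ev l v.
Proof. by rewrite /ev mulmxN mxE. Qed.

Lemma card_sat n (S : {set 'rV['F_3]_n}) (p : pred 'rV['F_3]_n) :
  #|[set s in S | p s]| = (\sum_(s in S) p s)%N.
Proof.
rewrite -sum1_card [LHS]big_mkcond [RHS]big_mkcond; apply: eq_bigr => c _.
by rewrite inE; case: (c \in S) => //=; case: (p c).
Qed.

(* The four hyperplanes of a pencil cover the space, and any two of them *)
(* meet in the axis of the pencil.                                       *)
Lemma pencil n (S : {set 'rV['F_3]_n}) (l m : 'cV['F_3]_n) :
  (#|[set s in S | ev l s == 0%R]| + #|[set s in S | ev m s == 0%R]|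
   + #|[set s in S | ev (l + m) s == 0%R]| + #|[set s in S | ev (l - m) s == 0%R]|
   = #|S| + 3 * #|[set s in S | (ev l s == 0%R) && (ev m s == 0%R)]|)%N.
Proof.
rewrite !card_sat -sum1_card big_distrr -!big_split /=.
apply: eq_bigr => c _; rewrite !ev_addl ev_oppl.
by case: (F3_cases (ev l c)) => ->; case: (F3_cases (ev m c)) => ->.
Qed.

Section Cap.

Variable C : {set 'rV['F_3]_6}.
Hypothesis srgC : strongly_regular 729 112 1 20 (cayley C).

Local Notation e := (cayley C).
Local Notation N := (neighbors e).

Lemma cap_neighbors : N 0 = C.
Proof. by apply/setP=> v; rewrite inE /cayley subr0. Qed.

Lemma cap_card : #|C| = 112%N.
Proof. by rewrite -cap_neighbors (card_neighbors srgC). Qed.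

Lemma cap0 : 0 \notin C.
Proof. by have := adj_irr srgC 0; rewrite /cayley subr0 => ->. Qed.

Lemma capN v : (- v \in C) = (v \in C).
Proof. by have := adj_sym srgC v 0; rewrite /cayley sub0r subr0. Qed.

Lemma double3 (v : 'rV['F_3]_6) : v + v = - v.
Proof. by apply/rowP=> i; rewrite !mxE; case: (F3_cases (v 0 i)) => ->; apply: val_inj. Qed.

Lemma cap_mate v : v \in C -> mate e 0 v = - v.
Proof.
move=> vC; apply/esym/(mate_uniq srgC); rewrite /cayley ?subr0 ?capN //.
by rewrite -opprD double3 opprK.
Qed.

(** The cap property: as lambda = 1, both [u] and [v] are the mate of [u + v] around 0. *)
Lemma cap_sum u v : u \in C -> v \in C -> u + v \in C -> u = v.
Proof.
move=> uC vC uvC.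
have uE : u = mate e 0 (u + v).
  apply: (mate_uniq srgC); rewrite /cayley ?subr0 //.
  by rewrite opprD addrA subrr sub0r capN.
have vE : v = mate e 0 (u + v).
  apply: (mate_uniq srgC); rewrite /cayley ?subr0 //.
  by rewrite opprD addrCA subrr addr0 capN.
by rewrite uE -vE.
Qed.

Definition level (l : 'cV['F_3]_6) a := [set c in C | ev l c == a].

Lemma level_opp l a : #|level l (- a)| = #|level l a|.
Proof.
rewrite -(card_imset _ (@oppr_inj 'rV['F_3]_6)); apply: eq_card => v.
rewrite !inE; apply/imsetP/andP => [[w + ->]|[vC /eqP va]].
  by rewrite !inE capN evN => /andP[-> /eqP->]; rewrite opprK.
by exists (- v); rewrite ?opprK // !inE capN vC evN va eqxx.
Qed.

Lemma card_level l a : #|level l a| = (\sum_(c in C) (ev l c == a))%N.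
Proof. exact: card_sat. Qed.

Lemma level_sum l : (#|level l 0%R| + 2 * #|level l 1%R| = 112)%N.
Proof.
rewrite mul2n -addnn -{2}(level_opp l 1) !card_level -!big_split -cap_card -sum1_card.
by apply: eq_bigr => c _ /=; case: (F3_cases (ev l c)) => ->.
Qed.

(** Twice the real part of the additive character of F_3^6 attached to [l], kept integral. *)
Definition wave (l : 'cV['F_3]_6) v : int := if ev l v == 0 then 2 else - 1.

Lemma wave_neighbors l v :
  \sum_(y in N v) wave l y = (#|level l 0%R|%:Z - #|level l 1%R|%:Z) * wave l v.
Proof.
transitivity (\sum_(c in C) wave l (v + c)).
  rewrite (reindex (+%R v)) /=; last by apply: onW_bij; exists (+%R (- v)); apply: addKr || apply: addNKr.
  by apply: eq_bigl => c; rewrite inE /cayley addrC addKr.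
transitivity (\sum_(c in C) (3 * (ev l c == - ev l v : nat)%:R - 1 : int)).
  by apply: eq_bigr => c _; rewrite /wave evD -addr_eq0 addrC; case: eqP.
rewrite sumrB -mulr_sumr -natr_sum -card_level sumr_const cap_card.
rewrite natz; have := level_sum l; rewrite /wave.
case: (F3_cases (ev l v)) => ->; rewrite ?oppr0 ?opprK ?level_opp //=.
all: move: #|level l 0%R| #|level l 1%R| => a b; clear; lia.
Qed.

Lemma wave_gram l x : l != 0 ->
  \sum_y gram e x y * wave l y =
  (108 - 27 * (#|level l 0%R|%:Z - #|level l 1%R|%:Z)) * wave l x.
Proof.
move=> l0; have sum0 : \sum_y wave l y = 0.
  have [v v1] : exists v, ev l v = 1.
    have /cV0Pn[i li] := l0.
    exists ((l i 0)^-1 *: delta_mx 0 i).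
    by rewrite /ev -scalemxAl -rowE !mxE mulVf.
  have shift (w : 'rV_6) : \sum_y wave l y = \sum_y wave l (y + w).
    by rewrite (reindex_inj (addIr w)).
  have: \sum_y wave l y + \sum_y wave l (y + v) + \sum_y wave l (y - v) = 0.
    rewrite -!big_split big1 // => y _; rewrite /wave !evD evN v1 /=.
    by case: (F3_cases (ev l y)) => ->.
  by rewrite -!shift; move: (\sum_y _) => S; clear; lia.
by rewrite gram_act wave_neighbors sum0; ring.
Qed.

(** [wave l] is an eigenvector of [gram] with eigenvalue 108 - 27 t. Since [gram] squares to 729
    [gram], this is 0 or 729, so t is 4 or -23, and [level_sum] gives the two sizes. *)
Lemma level_values l : l != 0 ->
  #|level l 0%R| = 40%N /\ #|level l 1%R| = 36%N \/ #|level l 0%R| = 22%N /\ #|level l 1%R| = 45%N.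
Proof.
move=> l0; set t := #|level l 0%R|%:Z - #|level l 1%R|%:Z.
have: \sum_x gram e 0 x * (\sum_y gram e x y * wave l y)
      = 729 * \sum_y gram e 0 y * wave l y.
  under eq_bigr => x _ do rewrite mulr_sumr.
  rewrite exchange_big mulr_sumr; apply: eq_bigr => z _ /=.
  by under eq_bigr => ? _ do rewrite mulrA; rewrite -mulr_suml (gram_sq srgC) mulrA.
under eq_bigr => x _ do rewrite wave_gram // mulrCA.
rewrite -mulr_sumr wave_gram // -/t /wave ev0 eqxx => /eqP.
rewrite mulrA -subr_eq0 mulrA -mulrBl mulf_eq0 orbF -mulrBl mulf_eq0.
have := level_sum l; move: @t; clear; lia.
Qed.

(** For a 22-hyperplane [wave l] lies in the eigenspace of -23, so it is orthogonal to the null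
    combination given by [gram_relation] for 0 and [v]. Mates around 0 are opposite vectors, where
    [wave l] agrees; the sum S over the common neighbours thus satisfies -15 + 40 + 5 S = 0, and S =
    3 k - 20 for the desired number k. *)
Lemma level22 l v : l != 0 -> #|level l 0%R| = 22%N -> ev l v != 0 -> v \notin C ->
  #|[set c in level l 0%R | v - c \in C]| = 5%N.
Proof.
move=> l0 n0 lv vC.
have n1 : #|level l 1%R| = 45%N by case: (level_values l0) => -[]; rewrite n0.
have v0 : 0 != v by apply: contraNneq lv => <-; rewrite ev0.
have n0v : ~~ e 0 v by rewrite /cayley subr0.
have : \sum_y weight e 0 v 15 20 4 1 y * wave l y = 0.
  have : \sum_x (\sum_y gram e x y * weight e 0 v 15 20 4 1 y) * wave l x = 0.
    by apply: big1 => x _; rewrite (gram_relation srgC) // mul0r.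
  under eq_bigr => x _ do rewrite mulr_suml.
  rewrite exchange_big (eq_bigr (fun y => 729 * (weight e 0 v 15 20 4 1 y * wave l y))).
    by rewrite -mulr_sumr; move: (\sum_y _) => S; clear; lia.
  move=> y _; transitivity (weight e 0 v 15 20 4 1 y * \sum_x gram e y x * wave l x).
    by rewrite mulr_sumr; apply: eq_bigr => x _; rewrite (gramC srgC); ring.
  by rewrite wave_gram // n0 n1; ring.
rewrite sum_weight.
have -> : \sum_(x in far e 0 v) wave l x = \sum_(x in N 0 :&: N v) wave l x.
  rewrite (far_mate srgC) big_imset /=; last first.
    move=> x y; rewrite cap_neighbors !inE => /andP[xC _] /andP[yC _].
    by rewrite !cap_mate // => /oppr_inj.
  apply: eq_bigr => x; rewrite cap_neighbors inE => /andP[xC _].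
  by rewrite cap_mate // /wave evN oppr_eq0.
have -> : \sum_(x in N 0 :&: N v) wave l x =
   3 * #|[set c in level l 0%R | v - c \in C]|%:Z - 20.
  transitivity (\sum_(c in N 0 :&: N v) (3 * (ev l c == 0 : nat)%:R - 1 : int)).
    by apply: eq_bigr => c _; rewrite /wave; case: eqP.
  rewrite sumrB -mulr_sumr sum_mem sumr_const (card_near srgC) // natz.
  congr (3 * Posz _ - _); apply: eq_card => c; rewrite cap_neighbors !inE /cayley.
  by rewrite -(capN (c - v)) opprB andbAC.
by rewrite /wave ev0 eqxx (negPf lv); clear; lia.
Qed.

Lemma level22_cap l v c : ev l v != 0 -> v \in C -> c \in level l 0%R -> v - c \notin C.
Proof.
move=> lv vC; rewrite inE => /andP[cC /eqP c0]; apply/negP=> vcC.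
have /(cap_sum vcC cC)E : v - c + c \in C by rewrite subrK.
by case/eqP: lv; rewrite -(subrK c v) evD E c0 addr0.
Qed.

Lemma wave_sum_neq0 (c : 'rV['F_3]_6) : c != 0 -> \sum_l wave l c = 0.
Proof.
case/rV0Pn=> i ci; pose m : 'cV['F_3]_6 := (c 0 i)^-1 *: delta_mx i 0.
have m1 : ev m c = 1 by rewrite /ev -scalemxAr -colE !mxE mulVf.
have shift (w : 'cV_6) : \sum_l wave l c = \sum_l wave (l + w) c.
  by rewrite (reindex_inj (addIr w)).
have: \sum_l wave l c + \sum_l wave (l + m) c + \sum_l wave (l - m) c = 0.
  rewrite -!big_split big1 // => l _; rewrite /wave !ev_addl ev_oppl m1 /=.
  by case: (F3_cases (ev l c)) => ->.
by rewrite -!shift; move: (\sum_l _) => S; clear; lia.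
Qed.

(** The sum of [wave l c] over all [l] and all [c] in [C] vanishes. The term [l = 0] contributes 224
    and a hyperplane with 40 vectors contributes 8, so not every hyperplane has 40. *)
Lemma exists_level22 : exists2 l, l != 0 & #|level l 0%R| = 22%N.
Proof.
have [/existsP[l /andP[l0 /eqP]]|/existsPn no22] :=
  boolP [exists l, (l != 0) && (#|level l 0%R| == 22%N)]; first by exists l.
have sumC l : \sum_(c in C) wave l c = 3 * #|level l 0%R|%:Z - 112.
  transitivity (\sum_(c in C) (3 * (ev l c == 0 : nat)%:R - 1 : int)).
    by apply: eq_bigr => c _; rewrite /wave; case: (ev l c == 0).
  by rewrite sumrB -mulr_sumr -natr_sum -card_level sumr_const cap_card natz.
have : \sum_l \sum_(c in C) wave l c = 0.
  rewrite exchange_big big1 // => c cC; apply: wave_sum_neq0.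
  by apply: contraTneq cC => ->; apply: cap0.
rewrite (bigD1 0) //= sumC.
have -> : level 0 0 = C.
  by apply/setP=> c; rewrite inE /ev mulmx0 mxE eqxx andbT.
rewrite cap_card (eq_bigr (fun=> 8)); last first.
  move=> l l0; rewrite sumC; have := no22 l; rewrite l0 /=.
  by case: (level_values l0) => -[-> _].
rewrite sumr_const => /eqP; have -> : 3 * 112%:Z - 112 = 224 by [].
by rewrite paddr_eq0 ?mulrn_wge0.
Qed.

Definition meet_level l m := [set c in C | (ev l c == 0) && (ev m c == 0)].

(** The other three members of the pencil have 22 or 40 vectors; [pencil] leaves 22, 40, 40 with
    axis 4, or 40, 40, 40 with axis 10. *)
Lemma meet_level22 l m : l != 0 -> #|level l 0%R| = 22%N ->
  m != 0 -> l + m != 0 -> l - m != 0 ->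
  #|meet_level l m| = 4%N \/ #|meet_level l m| = 10%N.
Proof.
move=> l0 n0 m0 lm0 lm0'; have := pencil C l m; rewrite -!/(level _ _) -/(meet_level l m) cap_card n0.
case: (level_values m0) => -[-> _]; case: (level_values lm0) => -[-> _];
  case: (level_values lm0') => -[-> _]; move: #|_| => z; clear; lia.
Qed.

Lemma pencil22 l m : l != 0 -> #|level l 0%R| = 22%N ->
  m != 0 -> l + m != 0 -> l - m != 0 -> #|meet_level l m| = 4%N ->
  exists2 m', #|level m' 0%R| = 22%N & [\/ m' = m, m' = l + m | m' = l - m].
Proof.
move=> l0 n0 m0 lm0 lm0' z4; have := pencil C l m; rewrite -!/(level _ _) -/(meet_level l m) cap_card n0 z4.
case: (level_values m0) => -[nm _]; first last.
  by move=> _; exists m => //; constructor 1.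
case: (level_values lm0) => -[nlm _]; first last.
  by move=> _; exists (l + m) => //; constructor 2.
case: (level_values lm0') => -[nlm' _]; first last.
  by move=> _; exists (l - m) => //; constructor 3.
by rewrite nm nlm nlm'.
Qed.

End Cap.

Local Close Scope ring_scope.

(** * Constraint propagation on ternary vectors *)

(** A bare type with three constructors keeps the searches cheap to evaluate; [F3] below reads [T2]
    as -1. *)
Inductive trit := T0 | T1 | T2.

Definition bool_of_trit t := match t with T0 => None | T1 => Some true | T2 => Some false end.
Definition trit_of_bool b := match b with None => T0 | Some true => T1 | Some false => T2 end.
Lemma bool_of_tritK : cancel bool_of_trit trit_of_bool. Proof. by case. Qed.
HB.instance Definition _ := Equality.copy trit (can_type bool_of_tritK).

Definition tadd a b := match a, b with
  | T0, _ => b | _, T0 => a | T1, T1 => T2 | T2, T2 => T1 | _, _ => T0 end.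
Definition topp a := match a with T0 => T0 | T1 => T2 | T2 => T1 end.
Definition tmul a b := match a with T0 => T0 | T1 => b | T2 => topp b end.

Notation vec := (seq trit).

Fixpoint veq (u v : vec) := match u, v with
  | [::], [::] => true
  | T0 :: u', T0 :: v' | T1 :: u', T1 :: v' | T2 :: u', T2 :: v' => veq u' v'
  | _, _ => false end.

Lemma veqE u v : veq u v = (u == v).
Proof. by elim: u v => [|[] u IHu] [|[] v] //=; rewrite IHu. Qed.

(* Under call by value [&&] and [||] evaluate both arguments: the following *)
(* variants of [all] and [has] stop as soon as possible.                    *)
Fixpoint lall A (p : A -> bool) s :=
  if s is x :: s' then if p x then lall p s' else false else true.
Fixpoint lhas A (p : A -> bool) s :=
  if s is x :: s' then if p x then true else lhas p s' else false.

Lemma lallE A (p : A -> bool) s : lall p s = all p s.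
Proof. by elim: s => //= x s ->; case: (p x). Qed.

Lemma lhasE A (p : A -> bool) s : lhas p s = has p s.
Proof. by elim: s => //= x s ->; case: (p x). Qed.

Definition vmem (s : seq vec) v := lhas (veq v) s.

Lemma vmemE s v : vmem s v = (v \in s).
Proof.
by rewrite /vmem lhasE; apply/hasP/idP => [[w ws]|vs]; [rewrite veqE => /eqP-> | exists v; rewrite ?veqE].
Qed.

Fixpoint vadd (u v : vec) : vec :=
  match u, v with a :: u', b :: v' => tadd a b :: vadd u' v' | _, _ => [::] end.
Definition vopp (u : vec) : vec := map topp u.
Fixpoint dot (u v : vec) :=
  match u, v with a :: u', b :: v' => tadd (tmul a b) (dot u' v') | _, _ => T0 end.
Definition zerov n : vec := nseq n T0.
Fixpoint lin n (c : vec) (ws : seq vec) : vec := match c, ws with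
  | T0 :: c', _ :: ws' => lin n c' ws'
  | T1 :: c', w :: ws' => vadd w (lin n c' ws')
  | T2 :: c', w :: ws' => vadd (vopp w) (lin n c' ws')
  | _, _ => zerov n end.
Definition iszero t := if t is T0 then true else false.
Fixpoint vecs n : seq vec := if n is m.+1 then
  let L := vecs m in map (cons T0) L ++ map (cons T1) L ++ map (cons T2) L else [:: [::]].
Fixpoint normal (v : vec) :=
  match v with T0 :: v' => normal v' | T1 :: _ => true | _ => false end.

(** A leaf above full depth stands for a constant subtree; thus [Lf None] is the state in which
    nothing is known. *)
Inductive trie (A : Type) := Lf of A | Nd of trie A & trie A & trie A.
Fixpoint get A (d : A) (t : trie A) (k : vec) : A := match t, k with
  | Lf x, _ => x
  | Nd a b c, x :: k' => get d (match x with T0 => a | T1 => b | T2 => c end) k'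
  | _, _ => d end.
Fixpoint put A (t : trie A) (k : vec) (v : A) : trie A := if k is x :: k' then
  let: (a, b, c) := match t with Lf y => (Lf y, Lf y, Lf y) | Nd a b c => (a, b, c) end in
  match x with
  | T0 => Nd (put a k' v) b c | T1 => Nd a (put b k' v) c | T2 => Nd a b (put c k' v)
  end else Lf v.

Fixpoint leb m n := match m, n with 0, _ => true | m'.+1, n'.+1 => leb m' n' | _, 0 => false end.

Lemma lebE m n : leb m n = (m <= n).
Proof. by elim: m n => [|m IHm] [|n] //=. Qed.

Arguments leb : simpl never.

Lemma get_put A (d : A) t k v k' : size k' = size k ->
  get d (put t k v) k' = if k' == k then v else get d t k'.
Proof.
elim: k k' t => [|x k IHk] [|x' k'] //= t [sz].
have getL y (j : vec) : get d (Lf y) j = y by case: j.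
rewrite eqseq_cons; case: t => [y|a b c]; case: x; case: x' => //=;
  rewrite ?getL // IHk //; case: (k' == k); rewrite ?getL //.
Qed.

(* A constraint asks that the total weight of the listed points lying in an *)
(* unknown set belongs to a list of values.                                 *)
Definition constraint := (seq (nat * vec) * seq nat)%type.
Definition state := trie (option bool).
Definition known (st : state) k := get None st k.

Definition mass (P : vec -> bool) (ws : seq (nat * vec)) := \sum_(wk <- ws) wk.1 * P wk.2.

Fixpoint tally (st : state) (ws : seq (nat * vec)) (lo un : nat) := match ws with
  | [::] => (lo, un)
  | (w, k) :: ws' => match known st k with
     | None => tally st ws' lo (w + un)
     | Some true => tally st ws' (w + lo) un
     | Some false => tally st ws' lo un end end.

Section Search.

Variable touch : vec -> bool -> seq constraint.

(** An unknown point of weight [w] is excluded if [lo + w] exceeds every allowed value, and included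
    if [lo + un - w] is below all of them. The bounds remain those of the entry state [st], which is
    enough for soundness. *)
Fixpoint force (st : state) lo un al (ws : seq (nat * vec)) (acc : state * seq constraint) :=
  match ws with
  | [::] => acc
  | (w, k) :: ws' => match known st k with
     | Some _ => force st lo un al ws' acc
     | None =>
       if lall (fun n => leb n.+1 (w + lo)) al then
         force st lo un al ws' (put acc.1 k (Some false), touch k false ++ acc.2)
       else if lall (fun n => leb (lo + un).+1 (w + n)) al then
         force st lo un al ws' (put acc.1 k (Some true), touch k true ++ acc.2)
       else force st lo un al ws' acc end end.

Fixpoint propagate fuel (st : state) (todo : seq constraint) : option state :=
  if fuel is f.+1 then match todo with
  | [::] => Some st
  | (ws, al) :: todo' =>
     let: (lo, un) := tally st ws 0 0 in
     if lhas (fun n => if leb lo n then leb n (lo + un) else false) al then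
       if un is 0 then propagate f st todo' else
       let: (st', todo'') := force st lo un al ws (st, todo') in propagate f st' todo''
     else None end else Some st.

Fixpoint first_unknown (st : state) (ws : seq (nat * vec)) : option vec :=
  if ws is (_, k) :: ws' then
    if known st k is None then Some k else first_unknown st ws'
  else None.

Fixpoint choose (st : state) (cs : seq constraint) : option vec :=
  if cs is (ws, _) :: cs' then
    if first_unknown st ws is Some k then Some k else choose st cs'
  else None.

(** Running out of depth or fuel keeps the current state as a candidate instead of dropping it, so
    that no solution is ever lost. *)
Fixpoint search depth fuel (cs : seq constraint) (st : state) (todo : seq constraint) : seq state :=
  if depth is d.+1 then
  match propagate fuel st todo with
  | None => [::]
  | Some st' => match choose st' cs with
     | None => if propagate fuel st' cs is Some st'' then [:: st''] else [::]
     | Some k =>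
       search d fuel cs (put st' k (Some true)) (touch k true) ++
       search d fuel cs (put st' k (Some false)) (touch k false) end end
  else [:: st].

Variables (n : nat) (P : vec -> bool).

Definition valid (c : constraint) :=
  all (fun wk => size wk.2 == n) c.1 && (mass P c.1 \in c.2).
Definition consistent (st : state) :=
  forall k b, size k = n -> known st k = Some b -> P k = b.

Hypothesis touch_valid : forall k b, size k = n -> {in touch k b, forall c, valid c}.

Lemma tallyE st ws lo un : tally st ws lo un =
  (\sum_(wk <- ws | known st wk.2 == Some true) wk.1 + lo,
   \sum_(wk <- ws | known st wk.2 == None) wk.1 + un).
Proof.
elim: ws lo un => [|[w k] ws IHws] lo un /=; first by rewrite !big_nil.
by rewrite !big_cons /=; case: (known st k) => [[]|] //=; rewrite IHws;
  congr (_, _); rewrite addnCA addnA.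
Qed.

Lemma mass_known st ws : consistent st -> all (fun wk => size wk.2 == n) ws ->
  mass P ws = \sum_(wk <- ws | known st wk.2 == Some true) wk.1
     + \sum_(wk <- ws | known st wk.2 == None) wk.1 * P wk.2.
Proof.
move=> cst /allP sz; rewrite /mass [X in _ = X + _]big_mkcond [X in _ = _ + X]big_mkcond.
rewrite -big_split big_seq [RHS]big_seq; apply: eq_bigr => -[w k] /sz /= /eqP szk.
by case E: (known st k) => [b|] //=; rewrite (cst k b) //; case: b {E}; rewrite ?muln1 ?muln0 ?addn0.
Qed.

Lemma put_consistent st k b : consistent st -> size k = n -> P k = b ->
  consistent (put st k (Some b)).
Proof.
move=> cst szk Pk k' b' szk'; rewrite /known get_put ?szk //.
by case: eqP => [-> [<-]|_] //; apply: cst.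
Qed.

Lemma force_sound st ws al lo un acc : consistent st ->
    valid (ws, al) -> tally st ws 0 0 = (lo, un) ->
    consistent acc.1 -> {in acc.2, forall c, valid c} ->
  let acc' := force st lo un al ws acc in
  consistent acc'.1 /\ {in acc'.2, forall c, valid c}.
Proof.
move=> cst /andP[/= sz tot_al]; rewrite tallyE !addn0 => -[loE unE].
have bound w k : (w, k) \in ws -> known st k = None ->
    (P k -> w + lo <= mass P ws) /\ (~~ P k -> mass P ws + w <= lo + un).
  move=> wk_ws kN; rewrite (mass_known cst sz) loE.
  have split_un (F : nat * vec -> nat) : \sum_(x <- ws | known st x.2 == None) F x =
      F (w, k) + \sum_(x <- rem (w, k) ws | known st x.2 == None) F x.
    by rewrite (big_rem _ wk_ws) /= kN eqxx.
  rewrite -unE !split_un /=; split=> Pk.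
    by rewrite Pk muln1 addnC leq_add2l leq_addr.
  rewrite (negPf Pk) muln0 add0n -addnA leq_add2l addnC leq_add2l.
  by apply: leq_sum => -[w' k'] _ /=; case: (P k'); rewrite ?muln1 ?muln0.
suff H s : {subset s <= ws} -> forall acc, consistent acc.1 -> {in acc.2, forall c, valid c} ->
   consistent (force st lo un al s acc).1 /\ {in (force st lo un al s acc).2, forall c, valid c}.
  by move=> c1 c2; apply: H.
  elim: s => [|[w k] s IHs] //= sub {}acc c1 c2.
  have {}IHs := IHs (fun x xs => sub x (@mem_behead _ ((w, k) :: s) x xs)).
  have wk_ws : (w, k) \in ws by apply: sub; rewrite mem_head.
  have szk : size k = n by apply/eqP; apply: (allP sz _ wk_ws).
  case kE: (known st k) => [b|]; first exact: IHs.
  have [Pk1 Pk0] := bound w k wk_ws kE.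
  rewrite lallE; case: allP => [allF|_].
    apply: IHs => /=.
      apply: put_consistent => //; apply: contraTF (allF _ tot_al).
      by rewrite lebE -leqNgt => /Pk1.
    by move=> c; rewrite mem_cat => /orP[/(touch_valid szk)|/c2].
  rewrite lallE; case: allP => [allT|_]; last exact: IHs.
  apply: IHs => /=.
    apply: put_consistent => //; apply: contraTT (allT _ tot_al).
    by rewrite lebE -leqNgt addnC => /Pk0.
  by move=> c; rewrite mem_cat => /orP[/(touch_valid szk)|/c2].
Qed.

Lemma propagate_sound fuel st todo : consistent st -> {in todo, forall c, valid c} ->
  if propagate fuel st todo is Some st' then consistent st' else False.
Proof.
elim: fuel st todo => [|f IHf] //= st [|[ws al] todo] //= cst val.
have vc := val _ (mem_head _ _).
have val' : {in todo, forall c, valid c}.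
  by move=> c ct; apply: val; rewrite inE ct orbT.
have [/= sz tot_al] := andP vc.
case tE: (tally st ws 0 0) => [lo un]; rewrite lhasE; case: hasP => [_|[]]; last first.
  exists (mass P ws) => //; rewrite !lebE; move: tE; rewrite tallyE !addn0 (mass_known cst sz) => -[-> <-].
  rewrite leq_addr leq_add2l.
  by apply: leq_sum => -[w' k'] _ /=; case: (P k'); rewrite ?muln1 ?muln0.
case: un tE => [|un] tE; first exact: IHf.
have [] := @force_sound _ _ _ _ _ (st, todo) cst vc tE cst val'.
by case: (force _ _ _ _ _ _) => st' todo' /=; apply: IHf.
Qed.

Lemma choose_size st cs k : {in cs, forall c, valid c} ->
  choose st cs = Some k -> size k = n.
Proof.
elim: cs => [|[ws al] cs IHcs] //= val.
have /andP[/= sz _] := val _ (mem_head _ _).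
have szk k' : first_unknown st ws = Some k' -> size k' = n.
  elim: ws sz {val} => [|[w k0] ws IHws] //= /andP[/eqP sz0 sz].
  by case: (known st k0) => [_|[<-]] //; apply: IHws.
case: (first_unknown st ws) szk => [k' szk [<-]|_]; first exact: szk.
by apply: IHcs => c cs_c; apply: val; rewrite inE cs_c orbT.
Qed.

(** On the branch that follows the values of [P] no constraint is ever refuted, since [P] satisfies
    them all; that branch ends in a listed state. *)
Lemma search_sound (Q : pred state) depth fuel cs st todo :
    {in cs, forall c, valid c} -> consistent st -> {in todo, forall c, valid c} ->
  all Q (search depth fuel cs st todo) -> exists2 st', consistent st' & Q st'.
Proof.
move=> cs_val; elim: depth st todo => [|d IHd] st todo cst val /=.
  by rewrite andbT; exists st.
have := propagate_sound fuel cst val.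
case: (propagate _ _ _) => [st'|] // cst'.
case E: (choose _ _) => [k|] /=; last first.
  have := propagate_sound fuel cst' cs_val.
  by case: (propagate _ _ _) => [st''|] //= cst''; rewrite andbT; exists st''.
have szk : size k = n by apply: choose_size E.
rewrite all_cat => /andP[allT allF].
case Pk: (P k); [apply: IHd allT | apply: IHd allF].
- exact: put_consistent.
- exact: touch_valid.
- exact: put_consistent.
- exact: touch_valid.
Qed.

End Search.

(** * The 11-cap, the slices and the two searches *)

Definition unitv n i : vec := [seq if j == i then T1 else T0 | j <- iota 0 n].
Definition basis n := [seq unitv n i | i <- iota 0 n].
Definition with_opp (s : seq vec) := s ++ map vopp s.

(* The 11-cap of PG(4,3) formed by the columns of a generator matrix of the *)
(* dual of the ternary Golay code, one vector per projective point.         *)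
Definition golay_half : seq vec :=
  [:: [:: T1; T2; T1; T1; T0]; [:: T0; T1; T1; T1; T2]; [:: T1; T0; T1; T2; T1];
      [:: T1; T1; T0; T2; T2]; [:: T1; T1; T2; T1; T1]; [:: T1; T2; T2; T0; T2]] ++ basis 5.
Definition golay := with_opp golay_half.

Definition hamming v := count (fun t => ~~ iszero t) v.

(* Antipodal pairs are counted once, so that the intersection numbers 4 and *)
(* 10 become 2 and 5.                                                       *)
Definition hyperplane (pts : seq vec) f : constraint :=
  ([seq (1, k) | k <- pts & iszero (dot f k)], [:: 2; 5]).

Definition solid (pts : seq vec) f g : constraint :=
  ([seq (1, k) | k <- pts & iszero (dot f k) && iszero (dot g k)], [:: 0; 1; 2; 3]).

Definition hyperplanes pts := [seq (f, hyperplane pts f) | f <-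
  basis 5 ++ [seq f <- pts | hamming f == 2]].

Definition solids pts := [seq solid pts fg.1 fg.2 | fg <-
  [seq (f, g) | f <- basis 5, g <- basis 5] & fg.1 != fg.2].

(** Which constraints are examined again only affects speed: after an exclusion, only the coordinate
    hyperplanes are. *)
Definition touch_golay (hs : seq (vec * constraint)) k b :=
  [seq fc.2 | fc <- hs & iszero (dot fc.1 k) && (b || (hamming fc.1 == 1))].

Definition start_golay : state :=
  foldr (fun k st => put st k (Some true)) (Lf None) (basis 5).

Definition golay_search pts :=
  let hs := hyperplanes pts in let cs := unzip2 hs in
  search (touch_golay hs) 60 2000 cs start_golay (solids pts ++ cs).

(* The basis being in the image of gol forces the lin 5 _ ws to be bijective. *)
Definition maps_golay (half gol full ws : seq vec) :=
  if lall (fun s => vmem full (lin 5 s ws)) half then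
  let img := [seq lin 5 s ws | s <- gol] in lall (vmem img) (basis 5) else false.

Definition e1 := unitv 5 0.
Definition e2 := unitv 5 1.
Definition e3 := unitv 5 2.

(* The last coordinate of the first vector of golay_half is 0, so that its *)
(* image is known as soon as the fourth row a is chosen.                   *)
Definition golay_leaf (pts half gol : seq vec) (st : state) :=
  all (fun k => known st k != None) pts &&
  let full := with_opp [seq k <- pts | if known st k is Some true then true else false] in
  lhas (fun a => if vmem full (lin 5 [:: T1; T2; T1; T1] [:: e1; e2; e3; a]) then
    lhas (fun b => maps_golay half gol full [:: e1; e2; e3; a; b]) full else false) full.

Definition normals n := [seq v <- vecs n | normal v].
Definition golay_check :=
  let pts := normals 5 in let half := golay_half in let gol := golay in
  all (golay_leaf pts half gol) (golay_search pts).

(* The cap is cut by the hyperplane at infinity x_6 = 0 along golay, and by a *)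
(* second 22-hyperplane sigma = 0, where sigma vanishes on golay only at the  *)
(* vectors e1, - e1, e2 and - e2. A slice is the trace of the cap on x_6 = 1. *)
Definition sigma : vec := [:: T0; T0; T1; T1; T1].
Definition slice0 := [seq v <- vecs 5 | iszero (dot sigma v)].

(* The weight 5 of x expresses that 5 translates of a vector x outside the *)
(* slice lie in it, against none if x belongs to it.                       *)
Definition neighborhood gol x : constraint :=
  ((5, x) :: [seq (1, vadd x k) | k <- gol], [:: 5]).

Definition neighborhoods gol : trie constraint :=
  foldr (fun x t => put t x (neighborhood gol x)) (Lf ([::], [:: 0])) (vecs 5).

Definition nbhd tab x : constraint := get ([::], [:: 0]) tab x.

Definition touch_slice tab (k : vec) (b : bool) : seq constraint :=
  if b then [seq nbhd tab wk.2 | wk <- (nbhd tab k).1] else [:: nbhd tab k].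

Definition start_slice (sl X : seq vec) : state :=
  foldr (fun v st => put st v (Some (vmem X v))) (Lf None) sl.

Definition slice_search sl tab all_nbhds X :=
  search (touch_slice tab) 60 2000 all_nbhds (start_slice sl X) (map (nbhd tab) sl).

(* A frame of sigma = 0 in which the cap reads golay: its first two vectors   *)
(* are common to both hyperplanes and the third one can be placed at the      *)
(* origin of the slice, which leaves r and s to be chosen.                    *)
Definition frame6 r s := [:: rcons e1 T0; rcons e2 T0; rcons (zerov 5) T1; rcons r T1; rcons s T1].

Definition section2 gol r s :=
  let fr := frame6 r s in [seq lin 6 c fr | c <- gol].

Definition slice2 gol r s :=
  [seq take 5 v | v <- section2 gol r s & if last T0 v is T1 then true else false].

Fixpoint vuniq (s : seq vec) :=
  if s is v :: s' then if vmem s' v then false else vuniq s' else true.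

(** Automorphisms of [gol] that preserve [sigma]: the basis vectors where [sigma] is 0 go to such
    vectors, and [e3] and the last two to vectors where it is 1. *)
Definition auts half gol :=
  let gs := [seq g <- gol | dot sigma g == T1] in
  [seq ws <- [seq [:: pq.1; pq.2; e3; ab.1; ab.2] |
     pq <- [seq (p, q) | p <- with_opp [:: e1; e2], q <- with_opp [:: e1; e2]],
     ab <- [seq (a, b) | a <- gs, b <- gs]] | maps_golay half gol gol ws].

(** Subtracting a member [y] changes which vector of the slice is placed at the origin. *)
Definition orbit aus X := flatten
  [seq let Y := [seq lin 5 k ws | k <- X] in
       [seq [seq vadd k (vopp y) | k <- Y] | y <- Y] | ws <- aus].

(** The characteristic word of [X] along [sl], used as a key that ignores the order of the list. *)
Definition canon sl (X : seq vec) : vec :=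
  let t := foldr (fun v t => put t v T1) (Lf T0) X in map (get T0 t) sl.

(* Keeps the cases that are not in the orbit of a former one. *)
Fixpoint classify sl aus (cs : seq (seq vec)) (tab : trie bool) (reps : seq (seq vec)) :=
  match cs with
  | [::] => reps
  | X :: cs' =>
    if get false tab (canon sl X) then classify sl aus cs' tab reps
    else classify sl aus cs'
      (foldr (fun Y t => put t (canon sl Y) true) tab (orbit aus X)) (X :: reps)
  end.

Definition cases gol sl := [seq X <- [seq slice2 gol r s | r <- sl, s <- sl] | vuniq X].

Definition member gol (st : state) (v : vec) :=
  let k := take 5 v in
  match last T0 v with
  | T0 => vmem gol k
  | T1 => if known st k is Some true then true else false
  | T2 => if known st (vopp k) is Some true then true else false
  end.

(* Found beforehand by computer: the images of the basis by linear maps taking *)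
(* the first cap reached by the search to each of the caps reached.            *)
Definition isomorphisms : seq (seq vec) :=
  [:: [:: [:: T0; T0; T0; T0; T0; T1]; [:: T0; T0; T0; T0; T1; T0];
          [:: T0; T1; T2; T2; T0; T2]; [:: T0; T1; T1; T0; T0; T2];
          [:: T2; T2; T0; T1; T1; T0]; [:: T2; T0; T0; T1; T2; T1]];
      [:: [:: T0; T0; T0; T0; T0; T1]; [:: T0; T0; T0; T0; T1; T0];
          [:: T0; T2; T2; T0; T2; T2]; [:: T0; T0; T2; T2; T0; T1];
          [:: T2; T2; T2; T1; T1; T1]; [:: T0; T1; T1; T1; T2; T0]];
      [:: [:: T0; T0; T0; T0; T0; T1]; [:: T0; T0; T0; T0; T1; T0];
          [:: T0; T0; T0; T1; T0; T0]; [:: T0; T2; T1; T0; T1; T1];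
          [:: T2; T2; T2; T2; T2; T2]; [:: T1; T2; T2; T2; T1; T1]];
      [:: [:: T0; T0; T0; T0; T0; T1]; [:: T0; T0; T0; T0; T1; T0];
          [:: T0; T1; T1; T0; T0; T1]; [:: T2; T1; T2; T2; T0; T0];
          [:: T0; T1; T0; T2; T2; T2]; [:: T1; T1; T0; T0; T1; T2]];
      [:: [:: T0; T0; T0; T0; T0; T1]; [:: T0; T0; T0; T0; T1; T0];
          [:: T0; T0; T2; T0; T0; T0]; [:: T2; T2; T0; T0; T1; T1];
          [:: T0; T2; T0; T1; T0; T2]; [:: T1; T0; T2; T2; T0; T1]]].

Definition cap_leaf gol (cap : seq vec) (st : state) :=
  lall (fun k => if known st k is None then false else true) (vecs 5) &&
  lhas (fun ws => let img := [seq lin 6 c ws | c <- cap] in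
    if lall (member gol st) img then lall (vmem img) (basis 6) else false)
    isomorphisms.

Definition slice_reps gol := let sl := slice0 in
  classify sl (auts golay_half gol) (cases gol sl) (Lf false) [::].

Definition leaves gol (reps : seq (seq vec)) :=
  let sl := slice0 in let tab := neighborhoods gol in
  let cs := map (nbhd tab) (vecs 5) in
  [seq slice_search sl tab cs X | X <- reps].

(** The first state reached serves as the reference cap. *)
Definition hill_of gol (sts : seq (seq state)) :=
  let st := head (Lf None) (flatten sts) in [seq v <- vecs 6 | member gol st v].

Definition hill := let gol := golay in hill_of gol (leaves gol (slice_reps gol)).

Definition hill_check :=
  let gol := golay in let reps := slice_reps gol in
  let sts := leaves gol reps in let cap := hill_of gol sts in
  [&& size cap == 112, lall (lall (vmem slice0)) reps
    & lall (lall (cap_leaf gol cap)) sts].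

Lemma golay_checkP : golay_check.
Proof. by vm_compute. Qed.

Lemma hill_checkP : hill_check.
Proof. by vm_compute. Qed.

(** * Ternary lists read as vectors over F_3 *)

Definition F3 (t : trit) : 'F_3 := match t with T0 => 0 | T1 => 1 | T2 => -1 end%R.

Lemma F3_add a b : F3 (tadd a b) = (F3 a + F3 b)%R.
Proof. by case: a; case: b; apply: val_inj. Qed.

Lemma F3_opp a : F3 (topp a) = (- F3 a)%R.
Proof. by case: a; apply: val_inj. Qed.

Lemma F3_mul a b : F3 (tmul a b) = (F3 a * F3 b)%R.
Proof. by case: a; case: b; apply: val_inj. Qed.

Lemma F3_inj : injective F3.
Proof. by case=> -[]. Qed.

Lemma F3_onto (a : 'F_3) : exists t, F3 t = a.
Proof. by case: (F3_cases a) => ->; [exists T0 | exists T1 | exists T2]. Qed.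

Lemma F3_eq0 t : (F3 t == 0%R) = iszero t.
Proof. by case: t. Qed.

Section Rows.

Variable n : nat.

Definition rowv (k : vec) : 'rV['F_3]_n := (\row_i F3 (nth T0 k i))%R.

Lemma rowv_inj u v : size u = n -> size v = n -> rowv u = rowv v -> u = v.
Proof.
move=> szu szv uv; apply: (@eq_from_nth _ T0) => [|i]; first by rewrite szu.
rewrite szu => ltin; apply: F3_inj.
by have /rowP/(_ (Ordinal ltin)) := uv; rewrite !mxE.
Qed.

Lemma rowv_onto (v : 'rV['F_3]_n) : exists2 k, size k = n & rowv k = v.
Proof.
have [t tE] := fin_all_exists (fun i : 'I_n => F3_onto (v 0%R i)).
exists (mkseq (fun i => if insub i is Some j then t j else T0) n); first by rewrite size_mkseq.
by apply/rowP=> i; rewrite mxE nth_mkseq // valK.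
Qed.

Lemma rowv_add u v : size u = n -> size v = n -> rowv (vadd u v) = (rowv u + rowv v)%R.
Proof.
move=> szu szv; apply/rowP=> i; rewrite !mxE -F3_add; congr F3.
have: i < size u by rewrite szu.
have: size u = size v by rewrite szu.
elim: u v (i : nat) {szu szv} => [|a u IHu] [|b v] // [|j] //= [] sz lt.
exact: IHu.
Qed.

Lemma rowv_opp u : rowv (vopp u) = (- rowv u)%R.
Proof.
apply/rowP=> i; rewrite !mxE -F3_opp; congr F3.
have [lt|ge] := ltnP i (size u); first by rewrite (nth_map T0).
by rewrite !nth_default ?size_map.
Qed.

Lemma rowv0 : rowv (zerov n) = 0%R.
Proof. by apply/rowP=> i; rewrite !mxE nth_nseq ltn_ord. Qed.

Lemma size_vadd u v : size u = n -> size v = n -> size (vadd u v) = n.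
Proof.
move=> <-; elim: u v => [|a u IHu] [|b v] //= [sz]; congr S; exact: IHu.
Qed.

Lemma size_lin c ws : all (fun w => size w == n) ws -> size (lin n c ws) = n.
Proof.
elim: c ws => [|a c IHc] [|w ws] //=; rewrite ?size_nseq //; first by case: a; rewrite size_nseq.
by case/andP=> /eqP szw szws; case: a; rewrite ?IHc // size_vadd ?size_map ?IHc.
Qed.

Definition rowsv m (ws : seq vec) : 'M['F_3]_(m, n) :=
  (\matrix_(i, j) F3 (nth T0 (nth [::] ws i) j))%R.

Lemma row_rowsv m ws i : row i (rowsv m ws) = rowv (nth [::] ws i).
Proof. by apply/rowP=> j; rewrite !mxE. Qed.

End Rows.

Lemma rowv_lin n m c ws : size c = m -> size ws = m ->
  all (fun w => size w == n) ws -> rowv n (lin n c ws) = (rowv m c *m rowsv n m ws)%R.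
Proof.
elim: c ws m => [|a c IHc] [|w ws] [|m] //=.
  by move=> _ _ _; rewrite rowv0; apply/rowP=> j; rewrite !mxE big_ord0.
move=> [szc] [szws] /andP[/eqP szw sz].
have -> : (rowv m.+1 (a :: c) *m rowsv n m.+1 (w :: ws))%R =
   (F3 a *: rowv n w + rowv m c *m rowsv n m ws)%R.
  by apply/rowP=> j; rewrite !mxE big_ord_recl !mxE; congr (_ + _)%R;
    apply: eq_bigr => i _; rewrite !mxE.
rewrite -(IHc ws m szc szws sz); case: a => /=.
- by rewrite scale0r add0r.
- by rewrite rowv_add ?size_lin // scale1r.
- by rewrite rowv_add ?size_lin ?size_map // rowv_opp scaleN1r.
Qed.

Lemma dotE n f v : size f = n -> size v = n -> F3 (dot f v) = ev ((rowv n f)^T)%R (rowv n v).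
Proof.
move=> szf szv; rewrite /ev mxE.
transitivity (\sum_(i < n) F3 (nth T0 f i) * F3 (nth T0 v i))%R; last first.
  by apply: eq_bigr => i _; rewrite !mxE mulrC.
elim: n f v szf szv => [|n IHn] [|a f] [|b v] //=; first by rewrite big_ord0.
by move=> [szf] [szv]; rewrite F3_add F3_mul (IHn f v) // big_ord_recl.
Qed.

Lemma mem_vecs n k : (k \in vecs n) = (size k == n).
Proof.
elim: n k => [|n IHn] [|a k] //=; rewrite !mem_cat; last first.
  have mapE (b : trit) : (a :: k \in map (cons b) (vecs n)) = (a == b) && (k \in vecs n).
    apply/mapP/andP => [[k' ? [-> ->]]|[/eqP-> ?]]; first by rewrite eqxx.
    by exists k.
  by rewrite !mapE {mapE} IHn eqSS; case: a; rewrite /= ?orbF.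
by apply/negP; rewrite !orbA => /orP[/orP[]|] /mapP[].
Qed.

Lemma uniq_vecs n : uniq (vecs n).
Proof.
elim: n => //= n IHn; have inj (b : trit) : injective (cons b) by move=> ? ? [].
rewrite !cat_uniq !map_inj_uniq // IHn /= andbT.
have dis (a b : trit) : a != b -> ~~ has (mem (map (cons a) (vecs n))) (map (cons b) (vecs n)).
  by move=> ab; apply/hasPn=> _ /mapP[k _ ->]; apply/mapP=> -[k' _ []] ba; rewrite ba eqxx in ab.
by rewrite has_cat negb_or !dis.
Qed.

Lemma perm_vecs n : perm_eq (map (rowv n) (vecs n)) (enum 'rV['F_3]_n).
Proof.
apply: uniq_perm; rewrite ?enum_uniq //.
  rewrite map_inj_in_uniq ?uniq_vecs // => u v; rewrite !mem_vecs => /eqP + /eqP.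
  exact: rowv_inj.
move=> v; rewrite mem_enum; apply/mapP; have [k szk <-] := rowv_onto v.
by exists k; rewrite ?mem_vecs ?szk.
Qed.

Lemma card_vecs n (A : {set 'rV['F_3]_n}) : #|A| = \sum_(k <- vecs n) (rowv n k \in A).
Proof.
rewrite -sum1_card big_mkcond -(big_map (rowv n) xpredT (fun v => nat_of_bool (v \in A))) /=.
rewrite (perm_big _ (perm_vecs n)) /= big_enum /=.
by apply: eq_bigr => v _; case: (v \in A).
Qed.

Lemma sum_vecs_opp n (G : vec -> nat) :
  \sum_(k <- vecs n) G (vopp k) = \sum_(k <- vecs n) G k.
Proof.
elim: n G => [|n IHn] G; first by rewrite !big_seq1.
rewrite /= !big_cat !big_map /=.
rewrite (IHn (fun k => G (T0 :: k))) (IHn (fun k => G (T1 :: k))) (IHn (fun k => G (T2 :: k))).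
by congr (_ + _); rewrite addnC.
Qed.

Lemma sum_vecs_normal n (G : vec -> nat) :
  \sum_(k <- vecs n) G k = G (zerov n) + \sum_(k <- normals n) (G k + G (vopp k)).
Proof.
elim: n G => [|n IHn] G; first by rewrite big_seq1 big_nil addn0.
rewrite /normals /= !filter_cat !big_cat !big_map (IHn (fun k => G (T0 :: k))) /=.
rewrite -addnA; congr (_ + (_ + _)).
  by rewrite /normals !filter_map big_map.
rewrite !filter_map (eq_filter (a2 := xpredT)) // filter_predT.
rewrite (eq_filter (a2 := pred0)) // filter_pred0 big_nil addn0 big_map big_split /=.
by rewrite (sum_vecs_opp n (fun k => G (T2 :: k))).
Qed.

(** * The 11-cap *)

Lemma size_unitv n i : size (unitv n i) = n.
Proof. by rewrite size_map size_iota. Qed.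

Lemma rowv_unitv n (i : 'I_n) : rowv n (unitv n i) = delta_mx 0%R i.
Proof.
apply/rowP=> j; rewrite !mxE (nth_map 0) ?size_iota // nth_iota // add0n eqxx /=.
by rewrite -val_eqE /=; case: eqP.
Qed.

Lemma size_golay k : k \in golay -> size k = 5.
Proof.
have: all (fun k => size k == 5) golay by vm_compute.
by move=> /allP sz /sz /eqP.
Qed.

Lemma basis_unitv n i : i < n -> unitv n i \in basis n.
Proof. by move=> lt; apply: map_f; rewrite mem_iota. Qed.

Lemma basisP n k : reflect (exists i : 'I_n, k = unitv n i) (k \in basis n).
Proof.
apply: (iffP mapP) => [[i]|[i ->]]; last first.
  by exists (i : nat); rewrite ?mem_iota ?ltn_ord.
by rewrite mem_iota => /= lt ->; exists (Ordinal lt).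
Qed.

Lemma voppK : involutive vopp.
Proof. by apply: mapK; case. Qed.

Lemma mem_with_opp s k : (k \in with_opp s) = (k \in s) || (vopp k \in s).
Proof.
by rewrite mem_cat -{2}(voppK k) mem_map //; apply: inv_inj voppK.
Qed.

Lemma get_fold A (d : A) (f : vec -> A) vs t n k : all (fun v => size v == n) vs ->
  size k = n ->
  get d (foldr (fun v t => put t v (f v)) t vs) k = if k \in vs then f k else get d t k.
Proof.
elim: vs => [|v vs IHvs] //= /andP[/eqP szv sz] szk.
by rewrite get_put ?szv // inE IHvs //; case: eqP => [->|].
Qed.

Definition golay_set : {set 'rV['F_3]_5} := [set v | v \in map (rowv 5) golay].

Lemma golay_setE k : size k = 5 -> (rowv 5 k \in golay_set) = (k \in golay).
Proof.
move=> szk; rewrite inE; apply/mapP/idP => [[k' k'g]|kg]; last by exists k.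
by move/(rowv_inj szk (size_golay k'g)) ->.
Qed.

Lemma golay_setN v : (- v \in golay_set)%R = (v \in golay_set).
Proof.
have [k szk <-] := rowv_onto v; rewrite -rowv_opp !golay_setE ?size_map //.
by rewrite !mem_with_opp orbC voppK.
Qed.

Lemma golay_setP v : reflect (exists2 k, k \in golay & v = rowv 5 k) (v \in golay_set).
Proof. by rewrite inE; apply: mapP. Qed.

Lemma card_golay : #|golay_set| = 22.
Proof.
have -> : golay_set = [set v in map (rowv 5) golay] by apply/setP=> v; rewrite !inE.
rewrite cardsE (card_uniqP _) ?size_map // map_inj_in_uniq.
  by have : uniq golay by vm_compute.
by move=> u v /size_golay szu /size_golay szv; apply: rowv_inj.
Qed.

(** The matrix is invertible because the image of [golay] contains the basis; an injective image of
    22 vectors inside the 22 vectors of [S] is all of [S]. *)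
Lemma maps_golayP (S : {set 'rV['F_3]_5}) full ws :
    (forall v, (- v \in S)%R = (v \in S)) -> #|S| = 22 ->
    {in full, forall k, rowv 5 k \in S} -> size ws = 5 ->
    all (fun w => size w == 5) ws -> maps_golay golay_half golay full ws ->
  rowsv 5 5 ws \in unitmx /\ forall v, (v *m rowsv 5 5 ws \in S)%R = (v \in golay_set).
Proof.
move=> SN Scard fullS szws szw; rewrite /maps_golay lallE.
case: ifP => // /allP half; rewrite lallE => /allP img.
set Q := rowsv 5 5 ws.
have linE k : k \in golay -> rowv 5 (lin 5 k ws) = (rowv 5 k *m Q)%R.
  by move=> /size_golay szk; apply: rowv_lin.
have Qunit : Q \in unitmx.
  rewrite -row_full_unit -sub1mx; apply/row_subP=> i.
  rewrite row1 -rowv_unitv; have := img _ (basis_unitv (ltn_ord i)).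
  by rewrite vmemE => /mapP[k kg ->]; rewrite linE // submxMl.
split=> // v.
have sub : {in golay_set, forall v, (v *m Q \in S)%R}.
  move=> _ /golay_setP[k kg ->]; move: (kg); rewrite mem_with_opp => /orP[kh|kh].
    by rewrite -linE // fullS // -vmemE; apply: half.
  rewrite -SN -mulNmx -rowv_opp -linE; last by rewrite mem_with_opp kh.
  by rewrite fullS // -vmemE; apply: half.
have injQ : injective (fun v : 'rV_5 => v *m Q)%R by apply: can_inj (mulmxK Qunit).
have imS : [set (v *m Q)%R | v in golay_set] = S.
  apply/eqP; rewrite eqEcard card_imset // card_golay Scard leqnn andbT.
  by apply/subsetP=> _ /imsetP[w wg ->]; apply: sub.
by rewrite -imS (mem_imset (f := fun v : 'rV_5 => v *m Q)%R).
Qed.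

Section GolayForm.

Variable S : {set 'rV['F_3]_5}.
Hypothesis SN : forall v, (- v \in S)%R = (v \in S).
Hypothesis S_card : #|S| = 22.
Hypothesis S_basis : forall i : 'I_5, delta_mx 0%R i \in S.
Hypothesis S_hyperplane : forall f : 'cV['F_3]_5, f != 0%R ->
  #|[set s in S | ev f s == 0%R]| = 4 \/ #|[set s in S | ev f s == 0%R]| = 10.

Let P (k : vec) : bool := rowv 5 k \in S.

(** The four hyperplanes of the pencil hold at most 40 vectors together, which [pencil] equates with
    22 plus three times the axis. *)
Lemma S_solid f g : f != 0%R -> g != 0%R -> (f + g != 0)%R -> (f - g != 0)%R ->
  #|[set s in S | (ev f s == 0%R) && (ev g s == 0%R)]| <= 6.
Proof.
move=> f0 g0 fg0 fg0'; have := pencil S f g; rewrite S_card.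
move: (S_hyperplane f0) (S_hyperplane g0) (S_hyperplane fg0) (S_hyperplane fg0').
by move: #|_| #|_| #|_| #|_| #|_| => a b c d z; clear; lia.
Qed.

(** A set closed under negation that contains 0 has odd size. *)
Lemma S_zero : 0%R \notin S.
Proof.
have f0 : delta_mx ord0 ord0 != 0%R :> 'cV['F_3]_5.
  by apply/eqP=> /matrixP/(_ ord0 ord0); rewrite !mxE eqxx.
apply/negP=> S0.
have even (A : {set 'rV['F_3]_5}) : 0%R \in A -> (forall v, (- v \in A)%R = (v \in A)) -> odd #|A|.
  move=> A0 AN; rewrite card_vecs sum_vecs_normal rowv0 A0.
  rewrite (eq_bigr (fun k => (rowv 5 k \in A).*2)) => [|k _]; last first.
    by rewrite rowv_opp AN addnn.
  rewrite oddD /= big_seq; elim/big_ind: _ => // [x y|k _]; last by rewrite odd_double.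
  by rewrite oddD => /negPf-> /negPf->.
by have := even S S0 SN; rewrite S_card.
Qed.

Lemma count_pairs (p : vec -> bool) (A : {set 'rV['F_3]_5}) :
    {subset A <= S} -> (forall v, (- v \in A)%R = (v \in A)) ->
    (forall k, size k = 5 -> (rowv 5 k \in A) = p k && (rowv 5 k \in S)) ->
  #|A| = (mass P [seq (1, k) | k <- normals 5 & p k]).*2.
Proof.
move=> AS AN Ap; rewrite card_vecs sum_vecs_normal rowv0.
have -> : 0%R \in A = false by apply: contraNF S_zero => /AS.
rewrite add0n /mass big_map big_filter -[RHS]muln2 big_distrl [RHS]big_mkcond /=.
rewrite big_seq [RHS]big_seq; apply: eq_bigr => k; rewrite mem_filter mem_vecs => /andP[_ /eqP szk].
by rewrite rowv_opp AN addnn Ap // mul1n; case: (p k); rewrite ?muln2.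
Qed.

Lemma evN_sym n (f : 'cV['F_3]_n) v : (ev f (- v) == 0)%R = (ev f v == 0)%R.
Proof. by rewrite evN oppr_eq0. Qed.

Lemma trV_neq0 k : size k = 5 -> k != zerov 5 -> ((rowv 5 k)^T != 0)%R.
Proof.
move=> szk; apply: contraNneq => k0; apply/eqP/(rowv_inj szk); rewrite ?size_nseq //.
by rewrite rowv0; apply: trmx_inj; rewrite k0 trmx0.
Qed.

Lemma hyperplane_valid f : size f = 5 -> f != zerov 5 -> valid 5 P (hyperplane (normals 5) f).
Proof.
move=> szf f0; apply/andP; split.
  apply/allP=> _ /mapP[k + ->] /=; rewrite !mem_filter mem_vecs.
  by case/and3P.
rewrite /hyperplane [_.1]/fst [_.2]/snd !inE; have := S_hyperplane (trV_neq0 szf f0).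
rewrite (count_pairs (p := fun k => iszero (dot f k))); first last.
- by move=> k szk; rewrite inE andbC -dotE // F3_eq0.
- by move=> v; rewrite !inE SN evN_sym.
- by move=> v; rewrite inE => /andP[].
by move: (mass _ _) => t [] t2; apply/orP; [left | right]; apply/eqP; move: t2; clear; lia.
Qed.

Lemma solid_valid f g : f \in basis 5 -> g \in basis 5 -> f != g ->
  valid 5 P (solid (normals 5) f g).
Proof.
case/basisP=> i -> /basisP[j ->] ij; apply/andP; split.
  apply/allP=> _ /mapP[k + ->] /=; rewrite !mem_filter mem_vecs.
  by case/and3P.
have {}ij : i != j by apply: contraNneq ij => ->.
have delta_T (k : 'I_5) : ((rowv 5 (unitv 5 k))^T)%R = delta_mx k 0%R :> 'cV['F_3]_5.
  by rewrite rowv_unitv trmx_delta.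
pose fi : 'cV['F_3]_5 := delta_mx i 0%R; pose fj : 'cV['F_3]_5 := delta_mx j 0%R.
have : #|[set s in S | (ev fi s == 0%R) && (ev fj s == 0%R)]| <= 6.
  apply: S_solid; apply/eqP.
  - by move/matrixP/(_ i 0%R); rewrite !mxE !eqxx.
  - by move/matrixP/(_ j 0%R); rewrite !mxE !eqxx.
  - by move/matrixP/(_ i 0%R); rewrite !mxE !eqxx (negPf ij).
  - by move/matrixP/(_ i 0%R); rewrite !mxE !eqxx (negPf ij).
rewrite (count_pairs (p := fun k => iszero (dot (unitv 5 i) k) && iszero (dot (unitv 5 j) k))); first last.
- by move=> k szk; rewrite inE andbC -!F3_eq0 !(@dotE 5) ?size_unitv // !delta_T.
- by move=> v; rewrite !inE SN !evN_sym.
- by move=> v; rewrite inE => /andP[].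
rewrite /solid [_.1]/fst [_.2]/snd !inE; move: (mass _ _) => t; clear => t3.
by case: t t3 => [|[|[|[|t]]]].
Qed.

(** The search starts from the basis and every outcome is matched with [golay] by a map fixing three
    basis vectors. This freedom lets three prescribed independent cap vectors play the roles of
    [e1], [e2] and [e3] later. *)
Lemma golay_form : exists Q : 'M['F_3]_5,
  [/\ Q \in unitmx, rowv 5 e1 *m Q = rowv 5 e1, rowv 5 e2 *m Q = rowv 5 e2,
      rowv 5 e3 *m Q = rowv 5 e3 & forall v, (v *m Q \in S) = (v \in golay_set)]%R.
Proof.
have basis_size k : k \in basis 5 -> size k = 5 by case/basisP=> i ->; rewrite size_unitv.
have hyp_valid fc : fc \in hyperplanes (normals 5) -> valid 5 P fc.2.
  case/mapP=> f + -> /=; rewrite mem_cat => /orP[fb|].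
    apply: hyperplane_valid; first exact: basis_size.
    by apply/eqP=> f0; move: fb; rewrite f0.
  rewrite mem_filter mem_filter mem_vecs => /and3P[_ fn /eqP szf].
  by apply: hyperplane_valid => //; apply/eqP=> f0; move: fn; rewrite f0.
have start : consistent 5 P start_golay.
  move=> k b szk; rewrite /known /start_golay (get_fold _ (fun=> Some true) _ (n := 5)) //.
  case kb: (k \in basis 5) => // -[<-]; case/basisP: kb => i ->.
  by rewrite /P rowv_unitv S_basis.
have hyps_valid : {in unzip2 (hyperplanes (normals 5)), forall c, valid 5 P c}.
  by move=> _ /mapP[fc /hyp_valid ? ->].
have todo_valid : {in solids (normals 5) ++ unzip2 (hyperplanes (normals 5)),
    forall c, valid 5 P c}.
  move=> c; rewrite mem_cat => /orP[/mapP[fg + ->]|]; last exact: hyps_valid.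
  rewrite mem_filter => /andP[ne /allpairsP[[f g] [/= fb gb E]]].
  by rewrite E in ne *; apply: solid_valid.
have touch_valid k b : size k = 5 ->
    {in touch_golay (hyperplanes (normals 5)) k b, forall c, valid 5 P c}.
  by move=> _ c /mapP[fc]; rewrite mem_filter => /andP[_ /hyp_valid ?] ->.
have := golay_checkP; rewrite /golay_check /golay_search; cbv zeta.
case/(search_sound touch_valid hyps_valid start todo_valid) => st cst.
case/andP=> _; cbv zeta; set full := with_opp _; rewrite lhasE => /hasP[a afull].
case: ifP => // _; rewrite lhasE => /hasP[b bfull maps].
have knownP k : k \in [seq k <- normals 5 | if known st k is Some true then true else false] ->
    rowv 5 k \in S /\ size k = 5.
  rewrite !mem_filter mem_vecs; case E: (known st k) => [[]|] //= /andP[_ /eqP szk].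
  by split=> //; apply: cst E.
have fullP k : k \in full -> rowv 5 k \in S /\ size k = 5.
  rewrite mem_with_opp => /orP[|]; first exact: knownP.
  by move/knownP; rewrite rowv_opp SN size_map.
have [ua ub] : size a = 5 /\ size b = 5 by case: (fullP a afull) (fullP b bfull) => _ ? [].
have szw : all (fun w => size w == 5) [:: e1; e2; e3; a; b] by rewrite /= ua ub.
have fullS k : k \in full -> rowv 5 k \in S by case/fullP.
have [|Qu QS] := maps_golayP SN S_card fullS _ szw maps; first by [].
exists (rowsv 5 5 [:: e1; e2; e3; a; b]).
have rowQ (i : 'I_5) : (rowv 5 (unitv 5 i) *m rowsv 5 5 [:: e1; e2; e3; a; b])%R =
    rowv 5 (nth [::] [:: e1; e2; e3; a; b] i).
  by rewrite rowv_unitv -rowE row_rowsv.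
split=> //; first exact: (rowQ (@Ordinal 5 0 isT)).
  exact: (rowQ (@Ordinal 5 1 isT)).
exact: (rowQ (@Ordinal 5 2 isT)).
Qed.

End GolayForm.

(** * Coordinates on a section by a 22-hyperplane *)

Local Open Scope ring_scope.

Lemma ev_eq0 n (l : 'cV['F_3]_n) v : (ev l v == 0) = (v *m l == 0).
Proof.
apply/eqP/eqP=> [vl|vl]; last by rewrite /ev vl mxE.
by apply/matrixP=> i j; rewrite !ord1 [RHS]mxE.
Qed.

Lemma ev_mul m n (B : 'M['F_3]_(m, n)) l v : ev l (v *m B) = ev (B *m l) v.
Proof. by rewrite /ev mulmxA. Qed.

Lemma row_free_col_mx (F : fieldType) m n (X : 'M[F]_(m, n)) (s : 'rV_n) :
  row_free X -> ~~ (s <= X)%MS -> row_free (col_mx X s).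
Proof.
rewrite /row_free => /eqP rX sX; rewrite -addsmxE eqn_leq addsmxE rank_leq_row /=.
have : (X < X + s)%MS by rewrite /ltmx addsmxSl addsmx_sub submx_refl.
by move/rank_ltmx; rewrite rX -addsmxE addn1.
Qed.

Section Section22.

Variable C : {set 'rV['F_3]_6}.
Hypothesis srgC : strongly_regular 729 112 1 20 (cayley C).
Variable l : 'cV['F_3]_6.
Hypotheses (l0 : l != 0) (n0 : #|level C l 0| = 22%N).

(* Otherwise a hyperplane other than [l] would contain all of [level C l 0], *)
(* while two hyperplanes share at most 10 of its points.                      *)
Lemma level22_span m (X : 'M['F_3]_(m, 6)) : (m < 5)%N ->
  exists2 s, s \in level C l 0 & ~~ (s <= X)%MS.
Proof.
move=> m5; have [/existsP[s /andP[? ?]]|/existsPn noS] :=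
  boolP [exists s, (s \in level C l 0) && ~~ (s <= X)%MS]; first by exists s.
have : ~~ ((cokermx X)^T <= l^T)%MS.
  apply/negP=> /mxrankS; rewrite mxrank_tr mxrank_coker.
  have := rank_leq_row X; have := rank_leq_row l^T.
  by move: (\rank X) (\rank l^T) m5 => a b; clear; lia.
case/row_subPn=> i il; pose f := col i (cokermx X).
have fl : ~~ (f^T <= l^T)%MS by rewrite tr_col.
have fX : {in level C l 0, forall s, ev f s = 0}.
  move=> s sS; apply/eqP; rewrite ev_eq0 /f -[col i _]/(col i _) colE mulmxA.
  by have := noS s; rewrite sS negbK /= submxE => /eqP->; rewrite mul0mx.
have f0 : f != 0 by apply: contraNneq fl => ->; rewrite trmx0 sub0mx.
have lf0 : l + f != 0.
  by apply: contraNneq fl => /eqP; rewrite addrC addr_eq0 => /eqP->; rewrite linearN /= eqmx_opp.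
have lf0' : l - f != 0.
  by apply: contraNneq fl => /eqP; rewrite subr_eq0 => /eqP->.
have : #|meet_level C l f| = 22%N.
  rewrite -n0; apply: eq_card => s; rewrite !inE andbA.
  by have := fX s; rewrite inE; case: (_ && _) => // ->.
by case: (meet_level22 srgC l0 n0 f0 lf0 lf0') => ->.
Qed.

Section Coordinates.

Variable B : 'M['F_3]_(5, 6).
Hypotheses (B_free : row_free B) (Bl : B *m l = 0).

Lemma section_coords c : ev l c = 0 -> exists v, c = v *m B.
Proof.
move=> lc; apply/submxP.
have sub : (B <= kermx l)%MS by apply/sub_kermxP.
have rk : \rank l = 1%N by apply/eqP; rewrite eqn_leq rank_leq_col lt0n mxrank_eq0.
have : (kermx l <= B)%MS.
  rewrite -(geq_leqif (mxrank_leqif_sup sub)) mxrank_ker rk.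
  by move/eqP: B_free => ->.
by apply: submx_trans; apply/sub_kermxP/eqP; rewrite -ev_eq0 lc.
Qed.

Lemma section_card (p : pred 'rV['F_3]_6) :
  #|[set v | (v *m B \in C) && p (v *m B)]| = #|[set c in level C l 0 | p c]|.
Proof.
have injB : injective (fun v : 'rV_5 => v *m B) by apply: row_free_inj.
rewrite -(card_imset _ injB); apply: eq_card => c; rewrite !inE.
apply/imsetP/andP=> [[v + ->]|[/andP[cC lc] pc]].
  by rewrite inE => /andP[-> ->]; rewrite ev_eq0 -mulmxA Bl mulmx0 eqxx.
by have [v cE] := section_coords (eqP lc); exists v; rewrite // inE -cE cC.
Qed.

(** A linear form on the section extends to the space through a right inverse of [B]. All of [m],
    [l + m] and [l - m] restrict to [f] or its opposite, so none of them is 0. *)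
Lemma section_hyperplane f : f != 0 ->
  exists m, [/\ B *m m = f, m != 0, l + m != 0, l - m != 0 &
   #|[set v | (v *m B \in C) && (ev f v == 0)]| = #|meet_level C l m|].
Proof.
move=> f0; have [B' BB'] := row_freeP B_free.
have BmE : B *m (B' *m f) = f by rewrite mulmxA BB' mul1mx.
exists (B' *m f); split=> //.
- by apply: contraNneq f0 => m0; rewrite -BmE m0 mulmx0.
- by apply: contraNneq f0 => m0; rewrite -BmE -[_ *m _]add0r -{1}Bl -mulmxDr m0 mulmx0.
- by apply: contraNneq f0 => m0; rewrite -oppr_eq0 -BmE -[- _]add0r -{1}Bl -mulmxBr m0 mulmx0.
transitivity #|[set c in level C l 0 | ev (B' *m f) c == 0]|.
  rewrite -(section_card (fun c => ev (B' *m f) c == 0)).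
  by apply: eq_card => v; rewrite !inE ev_mul BmE.
by apply: eq_card => c; rewrite !inE andbA.
Qed.

End Coordinates.

(** The three given vectors are extended by two more cap vectors, using [level22_span], to a basis
    of the hyperplane; in these coordinates [golay_form] applies. *)
Lemma section_form (X : 'M['F_3]_(3, 6)) :
    row_free X -> (forall i, row i X \in level C l 0) ->
  exists B : 'M['F_3]_(5, 6),
    [/\ row_free B, B *m l = 0, forall i : 'I_3, rowv 5 (unitv 5 i) *m B = row i X &
        forall v, (v *m B \in C) = (v \in golay_set)].
Proof.
move=> freeX Xl.
have [s sS sX] := level22_span X isT.
have free4 := row_free_col_mx freeX sX.
have [t tS tX] := level22_span (col_mx X s) isT.
have free5 := row_free_col_mx free4 tX; pose B := col_mx (col_mx X s) t.
have rowB (i : 'I_(3 + 1 + 1)) : row i B \in level C l 0.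
  case: (split_ordP i) => j ->; last by rewrite /B rowKd row_id // ord1.
  rewrite rowKu; case: (split_ordP j) => k ->; first by rewrite rowKu.
  by rewrite rowKd row_id // ord1.
have Bl : B *m l = 0.
  apply/row_matrixP=> i; rewrite row_mul row0.
  by have := rowB i; rewrite inE ev_eq0 => /andP[_ /eqP].
pose S := [set v : 'rV_5 | v *m B \in C].
have SN v : (- v \in S) = (v \in S) by rewrite !inE mulNmx capN.
have Scard : #|S| = 22%N.
  have := section_card free5 Bl xpredT; rewrite -n0.
  under eq_finset do rewrite andbT; move=> ->.
  by apply: eq_card => c; rewrite inE andbT.
have Sbasis i : delta_mx 0 i \in S.
  by rewrite inE -rowE; have := rowB i; rewrite inE => /andP[].
have Shyp f : f != 0 ->
    #|[set v in S | ev f v == 0]| = 4%N \/ #|[set v in S | ev f v == 0]| = 10%N.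
  case/(section_hyperplane free5 Bl) => m [_ m0 lm0 lm0'] E.
  have -> : [set v in S | ev f v == 0] = [set v | (v *m B \in C) && (ev f v == 0)].
    by apply/setP=> v; rewrite !inE.
  by rewrite E; apply: meet_level22.
have [Q [Qu Q1 Q2 Q3 QS]] := golay_form SN Scard Sbasis Shyp.
exists (Q *m B); split.
- by rewrite /row_free mxrankMfree // -[_ == _]/(row_free Q) row_free_unit.
- by rewrite -mulmxA Bl mulmx0.
- move=> i; have -> : rowv 5 (unitv 5 i) *m (Q *m B) = rowv 5 (unitv 5 i) *m B.
    by rewrite mulmxA; congr (_ *m _); case: i => -[|[|[|//]]].
  have -> : rowv 5 (unitv 5 i) = delta_mx 0 (lshift 1 (lshift 1 i) : 'I_5) by rewrite -rowv_unitv.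
  by rewrite -rowE; apply: etrans (rowKu _ _ _) (rowKu _ _ _).
- by move=> v; rewrite mulmxA -QS inE.
Qed.

Lemma section_form_any : exists B : 'M['F_3]_(5, 6),
  [/\ row_free B, B *m l = 0 & forall v, (v *m B \in C) = (v \in golay_set)].
Proof.
have [p pS pX] := level22_span (0 : 'M_(0, 6)) isT.
have free1 := row_free_col_mx (introT eqP (mxrank0 _ _ _)) pX.
have [q qS qX] := level22_span (col_mx (0 : 'M_(0, 6)) p) isT.
have free2 := row_free_col_mx free1 qX.
have [r rS rX] := level22_span (col_mx (col_mx (0 : 'M_(0, 6)) p) q) isT.
have free3 := row_free_col_mx free2 rX.
have rows (i : 'I_(0 + 1 + 1 + 1)) :
    row i (col_mx (col_mx (col_mx 0 p) q) r) \in level C l 0.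
  case: (split_ordP i) => j ->; last by rewrite rowKd row_id // ord1.
  rewrite rowKu; case: (split_ordP j) => k ->; last by rewrite rowKd row_id // ord1.
  by rewrite rowKu; case: (split_ordP k) => [[]|] // h ->; rewrite rowKd row_id // ord1.
by have [B [? ? _ ?]] := section_form free3 rows; exists B.
Qed.

End Section22.

(** * Two 22-hyperplanes *)

Definition moved n (C : {set 'rV['F_3]_n}) (D : 'M['F_3]_n) : {set 'rV['F_3]_n} :=
  [set v | v *m D \in C].

Lemma moved_srg n (C : {set 'rV['F_3]_n}) D v k l m : D \in unitmx ->
  strongly_regular v k l m (cayley C) -> strongly_regular v k l m (cayley (moved C D)).
Proof.
move=> Du; apply: (srg_iso (f := mulmxr D)) => [|x y]; last by rewrite /cayley inE mulmxBl.
by exists (mulmxr (invmx D)) => x /=; rewrite ?mulmxK ?mulmxKV.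
Qed.

Lemma moved_moved n (C : {set 'rV['F_3]_n}) D D' : moved (moved C D) D' = moved C (D' *m D).
Proof. by apply/setP=> v; rewrite !inE mulmxA. Qed.

Lemma moved_level (C : {set 'rV['F_3]_6}) D l a : D \in unitmx ->
  #|level (moved C D) (D *m l) a| = #|level C l a|.
Proof.
move=> Du; have injD : injective (fun v : 'rV_6 => v *m D) by apply: can_inj (mulmxK Du).
rewrite -(card_imset _ injD); apply: eq_card => c; rewrite !inE.
apply/imsetP/andP=> [[v + ->]|[cC lc]]; first by rewrite !inE ev_mul => /andP[-> ->].
by exists (c *m invmx D); rewrite ?mulmxKV // !inE mulmxKV // -ev_mul mulmxKV // cC.
Qed.

Lemma rowv_rcons n k t : size k = n ->
  rowv (n + 1) (rcons k t) = row_mx (rowv n k) (rowv 1 [:: t]).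
Proof.
move=> szk; apply/rowP=> i; case: (split_ordP i) => j ->.
  by rewrite row_mxEl !mxE nth_rcons szk /= ltn_ord.
by rewrite row_mxEr !mxE nth_rcons szk /= ord1 addn0 ltnn eqxx.
Qed.

Definition last_form : 'cV['F_3]_6 := (rowv 6 (rcons (zerov 5) T1))^T.
Definition sigma_form : 'cV['F_3]_6 := (rowv 6 (rcons sigma T0))^T.

Lemma count_golay (p : pred 'rV['F_3]_5) :
  #|[set v in golay_set | p v]| = count (fun k => p (rowv 5 k)) golay.
Proof.
rewrite -size_filter -(size_map (rowv 5)) -(card_uniqP _).
  apply: eq_card => v; rewrite inE; apply/andP/mapP=> [[/golay_setP[k kg ->] pk]|[k]].
    by exists k; rewrite // mem_filter pk.
  by rewrite mem_filter => /andP[pk kg] ->; split=> //; apply/golay_setP; exists k.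
have ug : uniq golay by vm_compute.
rewrite map_inj_in_uniq; first exact: filter_uniq.
move=> u v; rewrite !mem_filter => /andP[_ /size_golay szu] /andP[_ /size_golay szv].
exact: rowv_inj.
Qed.

Lemma golay_sigma : #|[set v in golay_set | ev (rowv 5 sigma)^T v == 0]| = 4%N.
Proof.
rewrite count_golay -(@eq_in_count _ (fun k => iszero (dot sigma k))).
  by vm_compute.
by move=> k /size_golay szk; rewrite -F3_eq0 (@dotE 5).
Qed.

Lemma rowv1 (a : trit) : rowv 1 [:: a] = (F3 a)%:M.
Proof. by apply/rowP=> i; rewrite !mxE !ord1. Qed.

Lemma form_rcons n k t : size k = n ->
  (rowv (n + 1) (rcons k t))^T = col_mx (rowv n k)^T (F3 t)%:M.
Proof. by move=> szk; rewrite rowv_rcons // tr_row_mx rowv1 tr_scalar_mx. Qed.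

(** A first 22-section is read as [golay]. Since [sigma] cuts it in 4 vectors, [pencil22] provides a
    second 22-hyperplane restricting to [sigma]. A cap vector of the second hyperplane outside the
    first completes the basis. *)
Lemma normal_frame (C : {set 'rV['F_3]_6}) : strongly_regular 729 112 1 20 (cayley C) ->
  exists D, [/\ D \in unitmx,
    forall k, size k = 5%N -> (rowv 6 (rcons k T0) \in moved C D) = (k \in golay),
    rowv 6 (rcons (zerov 5) T1) \in moved C D & #|level (moved C D) sigma_form 0| = 22%N].
Proof.
move=> srgC; have [l1 l0 n0] := exists_level22 srgC.
have [B [freeB Bl BC]] := section_form_any srgC l0 n0.
pose f := (rowv 5 sigma)^T.
have f0 : f != 0 by apply/eqP=> /matrixP/(_ (@Ordinal 5 2 isT) 0); rewrite !mxE.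
have golayB : [set v | (v *m B \in C) && (ev f v == 0)] = [set v in golay_set | ev f v == 0].
  by apply/setP=> v; rewrite !inE BC !inE.
have [l2 [Bl2 n2]] : exists l2, B *m l2 = f /\ #|level C l2 0| = 22%N.
  have [m [Bm m0 lm0 lm0' mE]] := section_hyperplane C l0 freeB Bl f0.
  rewrite golayB golay_sigma in mE.
  have [l2 n2 [l2E|l2E|l2E]] := pencil22 srgC l0 n0 m0 lm0 lm0' (esym mE).
  - by exists l2; split=> //; rewrite l2E.
  - by exists l2; split=> //; rewrite l2E mulmxDr Bl add0r.
  (* Here the second hyperplane restricts to [- f]; changing the sign of its form leaves the
     hyperplane unchanged. *)
  exists (- l2); split; first by rewrite l2E opprB mulmxBr Bl subr0.
  by rewrite -n2; apply: eq_card => c; rewrite !inE ev_oppl oppr_eq0.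
have [c [cC c1 c2]] : exists c, [/\ c \in C, ev l1 c = 1 & ev l2 c = 0].
  have meet4 : #|[set c in level C l1 0 | ev l2 c == 0]| = 4%N.
    rewrite -(section_card C l0 freeB Bl (fun c => ev l2 c == 0)).
    by rewrite -[RHS]golay_sigma -/f -golayB; apply: eq_card => v; rewrite !inE ev_mul Bl2.
  (* The second hyperplane has 22 cap vectors and only 4 of them lie in the first. *)
  have : ~~ (level C l2 0 \subset [set c in level C l1 0 | ev l2 c == 0]).
    by apply/negP=> /subset_leq_card; rewrite n2 meet4.
  case/subsetPn=> c; rewrite !inE => /andP[cC c2]; rewrite cC c2 /= andbT.
  case: (F3_cases (ev l1 c)) => c1; rewrite c1 ?eqxx // => _.
    by exists c; split=> //; apply/eqP.
  by exists (- c); rewrite (capN srgC) !evN c1 opprK (eqP c2) oppr0.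
pose D : 'M_6 := col_mx B c; exists D.
have cB : ~~ (c <= B)%MS.
  apply/negP=> /submxP[v cE]; have := c1; rewrite cE ev_mul Bl /ev mulmx0 mxE.
  by move/eqP; rewrite eq_sym oner_eq0.
have DE k t : size k = 5%N -> rowv 6 (rcons k t) *m D = rowv 5 k *m B + F3 t *: c.
  move=> szk; transitivity (row_mx (rowv 5 k) (rowv 1 [:: t]) *m col_mx B c).
    by rewrite (rowv_rcons (n := 5)).
  by rewrite mul_row_col rowv1 mul_scalar_mx.
have Du : D \in unitmx by rewrite -row_free_unit; apply: (row_free_col_mx freeB cB).
split=> //.
- by move=> k szk; rewrite inE DE // scale0r addr0 BC golay_setE.
- by rewrite inE DE // rowv0 mul0mx add0r scale1r.
have <- : D *m l2 = sigma_form.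
  transitivity (col_mx B c *m l2) => //; rewrite /sigma_form (form_rcons (n := 5)) //.
  rewrite mul_col_mx Bl2; apply: (congr1 (col_mx f)); apply/matrixP=> i j; rewrite !ord1 [RHS]mxE mulr1n.
  exact: c2.
by rewrite moved_level.
Qed.

Lemma vuniqE s : vuniq s = uniq s.
Proof. by elim: s => //= v s ->; rewrite vmemE; case: (v \in s). Qed.

Lemma row_free_rowsv n m ws : size ws = m -> all (fun w => size w == n) ws ->
  all (fun c => (lin n c ws == zerov n) ==> (c == zerov m)) (vecs m) -> row_free (rowsv n m ws).
Proof.
move=> szws szw /allP chk; apply: inj_row_free => v; have [c szc <-] := rowv_onto v.
rewrite -rowv_lin // -(rowv0 n) => /rowv_inj; rewrite size_lin // size_nseq => /(_ erefl erefl).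
have := chk c; rewrite mem_vecs szc eqxx => /(_ isT)/implyP c0 /eqP/c0/eqP->.
exact: rowv0.
Qed.

Lemma ev_sigma_form k t : size k = 5%N ->
  ev sigma_form (rowv 6 (rcons k t)) = F3 (dot sigma k).
Proof.
move=> szk; rewrite -dotE ?size_rcons ?szk //; congr F3.
by case: k szk => [|? [|? [|? [|? [|? [|]]]]]].
Qed.

Lemma ev_last_form k t : size k = 5%N -> ev last_form (rowv 6 (rcons k t)) = F3 t.
Proof.
move=> szk; rewrite -dotE ?size_rcons ?szk //; congr F3.
by case: k szk => [|? [|? [|? [|? [|? [|]]]]]] //; case: t.
Qed.

Lemma ev_row m n (B : 'M['F_3]_(m, n)) l i : ev l (row i B) = (B *m l) i 0.
Proof. by rewrite /ev -row_mul mxE. Qed.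

Lemma slice0P k : reflect (size k = 5%N /\ dot sigma k = T0) (k \in slice0).
Proof.
rewrite mem_filter mem_vecs; apply: (iffP andP) => [[dk /eqP]|[-> ->]] //.
by split=> //; case: (dot _ _) dk.
Qed.

Definition slice_cap (C : {set 'rV['F_3]_6}) :=
  forall k, size k = 5%N -> (rowv 6 (rcons k T0) \in C) = (k \in golay).

Definition embed : 'M['F_3]_(5, 6) := rowsv 6 5 [seq rcons k T0 | k <- basis 5].

Lemma embedE k : size k = 5%N -> rowv 5 k *m embed = rowv 6 (rcons k T0).
Proof.
move=> szk; rewrite -rowv_lin //; congr rowv.
by case: k szk => [|[] [|[] [|[] [|[] [|[] [|]]]]]].
Qed.

Lemma embed_free : row_free embed.
Proof. by apply: row_free_rowsv; rewrite ?size_map //; vm_compute. Qed.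

Lemma embed_last : embed *m last_form = 0.
Proof.
apply/colP=> i; rewrite -ev_row row_rowsv (nth_map [::]) ?size_map ?size_iota //.
by rewrite (nth_map 0%N) ?size_iota // ev_last_form ?mxE ?size_unitv.
Qed.

Lemma last_form_neq0 : last_form != 0.
Proof. by apply/eqP=> /matrixP/(_ (@Ordinal 6 5 isT) 0); rewrite !mxE. Qed.

Lemma sigma_form_neq0 : sigma_form != 0.
Proof. by apply/eqP=> /matrixP/(_ (@Ordinal 6 2 isT) 0); rewrite !mxE. Qed.

Lemma slice_cap_card C (p : pred 'rV['F_3]_6) : slice_cap C ->
  #|[set c in level C last_form 0 | p c]| = #|[set v in golay_set | p (v *m embed)]|.
Proof.
move=> sC; rewrite -(section_card C last_form_neq0 embed_free embed_last p).
apply: eq_card => v; have [k szk <-] := rowv_onto v.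
by rewrite [LHS]inE [RHS]inE embedE // sC // golay_setE.
Qed.

Lemma slice_cap_level C : slice_cap C -> #|level C last_form 0| = 22%N.
Proof.
move=> sC; rewrite -[RHS]card_golay.
transitivity #|[set c in level C last_form 0 | true]|; first by apply: eq_card => c; rewrite !inE andbT.
by rewrite slice_cap_card //; apply: eq_card => c; rewrite !inE andbT.
Qed.

Lemma section2P r s v : size r = 5%N -> size s = 5%N -> v \in section2 golay r s ->
  size v = 6%N.
Proof.
move=> szr szs /mapP[c _ ->]; rewrite size_lin //=.
by rewrite !size_rcons szr szs.
Qed.

Lemma mem_slice2 r s k : size r = 5%N -> size s = 5%N -> size k = 5%N ->
  (k \in slice2 golay r s) = (rcons k T1 \in section2 golay r s).
Proof.
move=> szr szs szk; apply/mapP/idP => [[v]|kv]; last first.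
  by exists (rcons k T1); rewrite ?mem_filter ?last_rcons ?kv // -szk -cats1 take_size_cat.
rewrite mem_filter => /andP[lv vs]; have := section2P szr szs vs.
case/lastP: v vs lv => [|v t] //; rewrite last_rcons size_rcons => + + [szv] kE.
by rewrite {}kE -cats1 -szv take_size_cat // cats1; case: t.
Qed.

Section Framed.

Variable C : {set 'rV['F_3]_6}.
Hypothesis srgC : strongly_regular 729 112 1 20 (cayley C).
Hypothesis C_slice : slice_cap C.
Hypothesis C_apex : rowv 6 (rcons (zerov 5) T1) \in C.
Hypothesis C_sigma : #|level C sigma_form 0| = 22%N.

(** The section [sigma = 0] is also a copy of [golay], in a frame that starts with [e1], [e2] and
    the apex. Only the last two frame vectors are unknown, and their last coordinates turn out to be
    1, as [frame6] prescribes. *)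
Lemma second_section : exists r s,
  [/\ slice2 golay r s \in cases golay slice0, all (fun k => size k == 5%N) (slice2 golay r s) &
  {in slice0, forall k, (rowv 6 (rcons k T1) \in C) = (k \in slice2 golay r s)}].
Proof.
pose ws := [:: rcons e1 T0; rcons e2 T0; rcons (zerov 5) T1].
have freeX : row_free (rowsv 6 3 ws) by apply: row_free_rowsv; vm_compute.
have rowX i : row i (rowsv 6 3 ws) \in level C sigma_form 0.
  rewrite row_rowsv inE; case: i => -[|[|[|//]]] lt3.
  - by rewrite -[nth _ _ _]/(rcons e1 T0) C_slice // ev_sigma_form.
  - by rewrite -[nth _ _ _]/(rcons e2 T0) C_slice // ev_sigma_form.
  - by rewrite -[nth _ _ _]/(rcons (zerov 5) T1) C_apex ev_sigma_form.
have [B [freeB Bs Brow BC]] := section_form srgC sigma_form_neq0 C_sigma freeX rowX.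
have rowB i : exists k, exists2 t, row i B = rowv 6 (rcons k t) & size k = 5%N /\ dot sigma k = T0.
  have [x szx xE] := rowv_onto (row i B).
  case/lastP: x szx xE => [|k t] //; rewrite size_rcons => -[szk] xE.
  exists k, t => //; split=> //; apply: F3_inj; rewrite -(ev_sigma_form t) // xE ev_row Bs mxE.
  by [].
have [r [a rE [szr sr]]] := rowB (@Ordinal 5 3 isT).
have [s [b sE [szs ss]]] := rowB (@Ordinal 5 4 isT).
pose fr := [:: rcons e1 T0; rcons e2 T0; rcons (zerov 5) T1; rcons r a; rcons s b].
have szfr : all (fun w => size w == 6%N) fr by rewrite /= !size_rcons szr szs.
have BE : B = rowsv 6 5 fr.
  apply/row_matrixP=> i; rewrite row_rowsv; case: i => -[|[|[|[|[|//]]]]] lt5.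
  - have := Brow (@Ordinal 3 0 isT); rewrite (rowv_unitv (@Ordinal 5 0 isT)) -rowE row_rowsv => <-.
    by congr (row _ _); apply: val_inj.
  - have := Brow (@Ordinal 3 1 isT); rewrite (rowv_unitv (@Ordinal 5 1 isT)) -rowE row_rowsv => <-.
    by congr (row _ _); apply: val_inj.
  - have := Brow (@Ordinal 3 2 isT); rewrite (rowv_unitv (@Ordinal 5 2 isT)) -rowE row_rowsv => <-.
    by congr (row _ _); apply: val_inj.
  - by rewrite -rE; congr (row _ _); apply: val_inj.
  - by rewrite -sE; congr (row _ _); apply: val_inj.
(* The last coordinate read in the frame. The two 22-sections share exactly 4 vectors, and among the
   nine choices of [a] and [b] only [a = b = T1] makes this form vanish on 4 vectors of [golay]. *)
pose lf := [:: T0; T0; T1; a; b].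
have Blast : B *m last_form = (rowv 5 lf)^T.
  apply/colP=> i; rewrite -ev_row BE row_rowsv !mxE; case: i => -[|[|[|[|[|//]]]]] lt5.
  - by rewrite -[nth _ fr _]/(rcons e1 T0) ev_last_form.
  - by rewrite -[nth _ fr _]/(rcons e2 T0) ev_last_form.
  - by rewrite -[nth _ fr _]/(rcons (zerov 5) T1) ev_last_form.
  - by rewrite -[nth _ fr _]/(rcons r a) ev_last_form.
  - by rewrite -[nth _ fr _]/(rcons s b) ev_last_form.
have count4 : count (fun k => iszero (dot lf k)) golay = 4%N.
  have <- := golay_sigma.
  have -> : #|[set v in golay_set | ev (rowv 5 sigma)^T v == 0]| =
    #|[set c in level C last_form 0 | ev sigma_form c == 0]|.
    rewrite slice_cap_card //; apply: eq_card => v; rewrite !inE; congr (_ && _).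
    have [k szk <-] := rowv_onto v; rewrite embedE // ev_sigma_form //.
    by rewrite -dotE.
  transitivity #|[set c in level C sigma_form 0 | ev last_form c == 0]|; last first.
    by apply: eq_card => c; rewrite [LHS]inE [RHS]inE ![c \in level _ _ _]inE andbAC.
  rewrite -(section_card C sigma_form_neq0 freeB Bs (fun c => ev last_form c == 0)).
  rewrite -(@eq_in_count _ (fun k => ev (rowv 5 lf)^T (rowv 5 k) == 0)).
    apply: etrans (esym (count_golay (fun v => ev (rowv 5 lf)^T v == 0))) _.
    by apply: eq_card => v; rewrite [LHS]inE [RHS]inE BC ev_mul Blast.
  by move=> k /size_golay szk; rewrite -dotE // F3_eq0.
have count4P x y : count (fun k => iszero (dot [:: T0; T0; T1; x; y] k)) golay = 4%N ->
    x = T1 /\ y = T1 by case: x; case: y; vm_compute.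
have [aE bE] := count4P _ _ count4.
have {lf Blast count4} frE : fr = frame6 r s by rewrite /fr aE bE.
have mem6 k : k \in slice0 -> (rowv 6 (rcons k T1) \in C) = (k \in slice2 golay r s).
  case/slice0P=> szk sk; rewrite mem_slice2 //; apply/idP/mapP => [kC|[c cg ->]]; last first.
    by rewrite -frE (rowv_lin (m := 5)) ?(size_golay cg) // -BE BC golay_setE ?(size_golay cg).
  have [|v vE] := section_coords sigma_form_neq0 freeB Bs (c := rowv 6 (rcons k T1)).
    by rewrite ev_sigma_form // sk.
  have [c szc cE] := rowv_onto v; exists c.
    by rewrite -golay_setE // cE -BC -vE.
  rewrite -frE; apply: (rowv_inj (n := 6)); rewrite ?size_rcons ?szk ?size_lin //.
  by rewrite vE -cE (rowv_lin (m := 5)) // BE.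
exists r, s; split; last exact: mem6; last first.
  apply/allP=> _ /mapP[v + ->]; rewrite mem_filter => /andP[_ /(section2P szr szs) szv].
  by rewrite size_take szv.
rewrite mem_filter vuniqE (allpairs_f (fun r s => slice2 golay r s)) ?andbT; first last.
- by apply/slice0P.
- by apply/slice0P.
rewrite map_inj_in_uniq.
  rewrite filter_uniq // map_inj_in_uniq; first by vm_compute.
  move=> c d /size_golay szc /size_golay szd /(congr1 (rowv 6)).
  rewrite -frE !(rowv_lin (m := 5)) // -BE => /(row_free_inj freeB).
  exact: rowv_inj.
move=> u v; rewrite !mem_filter => /andP[lu us] /andP[lv vs].
have := section2P szr szs us; have := section2P szr szs vs.
case/lastP: u lu {us} => [|u t] //; case/lastP: v lv {vs} => [|v t'] //.
rewrite !last_rcons !size_rcons => t1' t1 [szv] [szu].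
rewrite -!cats1 -{1}szu -{1}szv !take_size_cat // => ->.
by case: t t1; case: t' t1'.
Qed.

End Framed.

(** * Slices *)

Lemma canonE sl X Y n : all (fun v => size v == n) sl ->
    all (fun v => size v == n) X -> all (fun v => size v == n) Y ->
  canon sl X = canon sl Y -> {in sl, X =i Y}.
Proof.
move=> /allP szsl szX szY /eq_in_map XY v vsl; have := XY v vsl.
rewrite !(get_fold _ (fun=> T1) _ (n := n)) //; try exact/eqP/szsl.
by case: (v \in X); case: (v \in Y); case: v {XY vsl}.
Qed.

(* [tab] records the orbits of the representatives found so far. *)
Lemma classify_sound sl aus cs tab reps :
    (forall key, size key = size sl -> get false tab key ->
      exists rep Y, [/\ rep \in reps, Y \in orbit aus rep & canon sl Y = key]) ->
  {subset reps <= classify sl aus cs tab reps} /\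
  {in cs, forall X, exists2 rep, rep \in classify sl aus cs tab reps &
     X = rep \/ exists2 Y, Y \in orbit aus rep & canon sl X = canon sl Y}.
Proof.
have szc X : size (canon sl X) = size sl by rewrite size_map.
elim: cs tab reps => [|X cs IHcs] tab reps tabP /=; first by split=> // X.
case seen: (get _ _ _).
  have [sub IH] := IHcs _ _ tabP; split=> // Z; rewrite inE => /orP[/eqP->|]; last exact: IH.
  have [rep [Y [rin Yin YE]]] := tabP _ (szc X) seen.
  by exists rep; [exact: sub | right; exists Y].
rewrite -(foldr_map (canon sl) (fun key t => put t key true)).
set tab' := foldr _ _ _.
have tabP' key : size key = size sl -> get false tab' key ->
    exists rep Y, [/\ rep \in X :: reps, Y \in orbit aus rep & canon sl Y = key].
  move=> szk; rewrite (get_fold _ (fun=> true) _ (n := size sl)) //; last first.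
    by apply/allP=> _ /mapP[Y _ ->]; rewrite szc.
  case: ifP => [/mapP[Y Yin ->] _|_ /(tabP _ szk)[rep [Y [rin Yin YE]]]].
    by exists X, Y; rewrite inE eqxx.
  by exists rep, Y; rewrite inE rin orbT.
have [sub IH] := IHcs _ _ tabP'; split=> [Y Yin|Z].
  by apply: sub; rewrite inE Yin orbT.
rewrite inE => /orP[/eqP->|]; last exact: IH.
by exists X; [apply: sub; rewrite inE eqxx | left].
Qed.

Lemma orbitP aus X Y : Y \in orbit aus X -> exists ws y,
  [/\ ws \in aus, y \in X &
      Y = [seq vadd (lin 5 k ws) (vopp (lin 5 y ws)) | k <- X]].
Proof.
case/flattenP=> _ /mapP[ws wsin ->] /mapP[_ /mapP[y yX ->] ->].
by exists ws, y; rewrite -map_comp.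
Qed.

Lemma autsP ws : ws \in auts golay_half golay ->
  [/\ size ws = 5%N, all (fun w => size w == 5%N) ws, map (dot sigma) ws = sigma &
      maps_golay golay_half golay golay ws].
Proof.
rewrite mem_filter => /andP[maps /allpairsP[[[p q] [a b]] [pq ab wsE]]].
have {pq} [pin qin] : p \in with_opp [:: e1; e2] /\ q \in with_opp [:: e1; e2].
  by move: pq => /allpairsP[[u v] /= [uin vin [-> ->]]].
have {ab} [ain bin] : a \in [seq g <- golay | dot sigma g == T1] /\
    b \in [seq g <- golay | dot sigma g == T1].
  by move: ab => /allpairsP[[u v] /= [uin vin [-> ->]]].
have small v : v \in with_opp [:: e1; e2] -> (size v == 5%N) && (dot sigma v == T0).
  by apply/allP: v; vm_compute.
have unit v : v \in [seq g <- golay | dot sigma g == T1] -> (size v == 5%N) && (dot sigma v == T1).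
  by rewrite mem_filter => /andP[-> /size_golay ->].
move: maps; rewrite wsE => maps; split=> //.
  rewrite /=.
  by case/andP: (small _ pin) => -> _; case/andP: (small _ qin) => -> _;
     case/andP: (unit _ ain) => -> _; case/andP: (unit _ bin) => -> _.
case/andP: (small _ pin) => _ /eqP sp; case/andP: (small _ qin) => _ /eqP sq.
case/andP: (unit _ ain) => _ /eqP sa; case/andP: (unit _ bin) => _ /eqP sb.
by rewrite 5!map_cons sp sq sa sb.
Qed.

Lemma dot_lin ws k : size k = 5%N -> size ws = 5%N -> all (fun w => size w == 5%N) ws ->
  map (dot sigma) ws = sigma -> dot sigma (lin 5 k ws) = dot sigma k.
Proof.
move=> szk szws szw sws; apply: F3_inj; rewrite !(@dotE 5) ?size_lin //.
rewrite (rowv_lin (m := 5)) // ev_mul; congr (ev _ _).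
apply/colP=> i; rewrite -ev_row row_rowsv.
have lt : (i < size ws)%N by rewrite szws.
rewrite -dotE ?(eqP (allP szw _ (mem_nth _ lt))) //.
by rewrite -(nth_map _ T0) // sws !mxE.
Qed.

(* The affine maps [k |-> lin 5 k ws - y] of the slice at height 1, extended *)
(* linearly to the whole space.                                              *)
Lemma slice_change ws y : size ws = 5%N -> all (fun w => size w == 5%N) ws -> size y = 5%N ->
    rowsv 5 5 ws \in unitmx ->
  exists2 D, D \in unitmx & forall k, size k = 5%N ->
    rowv 6 (rcons k T0) *m D = rowv 6 (rcons (lin 5 k ws) T0) /\
    rowv 6 (rcons k T1) *m D = rowv 6 (rcons (vadd (lin 5 k ws) (vopp y)) T1).
Proof.
move=> szws szw szy Hu; set H := rowsv 5 5 ws in Hu.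
have Du : block_mx H 0 (- rowv 5 y) 1%:M \in unitmx.
  by rewrite unitmxE det_lblock det1 mulr1 -unitmxE.
exists (block_mx H 0 (- rowv 5 y) 1%:M) => // k szk.
have szl : size (lin 5 k ws) = 5%N by rewrite size_lin.
have szv : size (vadd (lin 5 k ws) (vopp y)) = 5%N by rewrite (@size_vadd 5) // size_map.
have DE t : rowv (5 + 1) (rcons k t) *m block_mx H 0 (- rowv 5 y) 1%:M =
    row_mx (rowv 5 (lin 5 k ws) - F3 t *: rowv 5 y) (rowv 1 [:: t]).
  rewrite rowv_rcons // mul_row_block rowv1 !mul_scalar_mx mulmx0 add0r scalerN.
  by rewrite (rowv_lin (m := 5)) // scale_scalar_mx mulr1.
split; apply: etrans (DE _) _.
  by rewrite scale0r subr0 (rowv_rcons (n := 5)).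
by rewrite scale1r -rowv_opp -rowv_add ?size_map // (rowv_rcons (n := 5)).
Qed.

(** The affine map from [X] to the member of its orbit extends to a linear [D] that preserves
    [golay] at infinity; pulling [C] back along [D] replaces that member by [X]. *)
Lemma slice_transport C X ws y : slice_cap C -> {subset X <= slice0} -> y \in X ->
    ws \in auts golay_half golay ->
    {in slice0, forall k, (rowv 6 (rcons k T1) \in C) =
      (k \in [seq vadd (lin 5 k ws) (vopp (lin 5 y ws)) | k <- X])} ->
  exists D, [/\ D \in unitmx, slice_cap (moved C D) &
    {in slice0, forall k, (rowv 6 (rcons k T1) \in moved C D) = (k \in X)}].
Proof.
move=> sC X0 yX /autsP[szws szw sws maps] kC.
have szX k : k \in X -> size k = 5%N by move/X0/slice0P=> [].
have [Hu HG] := maps_golayP golay_setN card_golay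
  (fun k kg => etrans (golay_setE (size_golay kg)) kg) szws szw maps.
have szl k : size (lin 5 k ws) = 5%N by rewrite size_lin.
have [D Du DE] := slice_change szws szw (szl y) Hu.
exists D; split=> // [k szk|k k0].
  rewrite inE (proj1 (DE k szk)) sC //.
  by rewrite -golay_setE // (rowv_lin (m := 5)) // HG golay_setE.
have [szk sk] := slice0P _ k0.
have [szy sy] := slice0P _ (X0 _ yX).
have szv j : size (vadd (lin 5 j ws) (vopp (lin 5 y ws))) = 5%N.
  by rewrite (@size_vadd 5) ?size_map ?szl.
rewrite inE (proj2 (DE k szk)) kC; last first.
  apply/slice0P; split; first exact: szv.
  apply: F3_inj; rewrite (@dotE 5) // rowv_add ?size_map ?szl // rowv_opp evD evN.
  by rewrite -!dotE // !dot_lin // sk sy /= subr0.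
apply/mapP/idP => [[j jX E]|kX]; last by exists k.
have szj := szX j jX; suff -> : k = j by [].
apply: (rowv_inj szk szj); have := congr1 (rowv 5) E.
rewrite !rowv_add ?size_map ?szl // => /addIr; rewrite !(rowv_lin (m := 5)) //.
by move/(can_inj (mulmxK Hu)).
Qed.

Lemma slice_reps_sub X : X \in slice_reps golay -> {subset X <= slice0}.
Proof.
move=> Xrep; have := hill_checkP; rewrite /hill_check; cbv zeta => /and3P[_ + _].
by rewrite lallE => /allP/(_ _ Xrep); rewrite lallE => /allP sub k /sub; rewrite vmemE.
Qed.

Lemma canonical_slice C : strongly_regular 729 112 1 20 (cayley C) ->
  exists D X, [/\ D \in unitmx, X \in slice_reps golay, slice_cap (moved C D) &
    {in slice0, forall k, (rowv 6 (rcons k T1) \in moved C D) = (k \in X)}].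
Proof.
move=> srgC; have [D [Du sC apex sig]] := normal_frame srgC.
have [r [s [case2 szs kC]]] := second_section (moved_srg Du srgC) sC apex sig.
have [|_ /(_ _ case2)[X + XE]] := @classify_sound slice0 (auts golay_half golay)
  (cases golay slice0) (Lf false) [::]; first by [].
rewrite -[classify _ _ _ _ _]/(slice_reps golay) => Xrep; have X0 := slice_reps_sub Xrep.
case: XE => [XE|[Y /orbitP[ws [y [wsin yX YE]]] canY]].
  exists D, X; split; [exact: Du | exact: Xrep | exact: sC |] => k.
  by rewrite -XE; apply: kC.
have [|D' [Du' sC' D'X]] := slice_transport sC X0 yX wsin; last first.
  exists (D' *m D), X; rewrite -moved_moved.
  split.
  - rewrite unitmx_mul Du'; exact: Du.
  - exact: Xrep.
  - exact: sC'.
  - exact: D'X.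
move=> k k0; rewrite (kC _ k0) -YE.
have sz0 : all (fun v => size v == 5%N) slice0 by apply/allP=> j /slice0P[/eqP].
apply: (canonE (n := 5) sz0 szs _ canY k0); rewrite YE all_map.
have [szws szw _ _] := autsP wsin.
by apply/allP=> j _ /=; rewrite (@size_vadd 5) ?size_map ?size_lin.
Qed.

(** * Completing a slice to the whole cap *)

Lemma vadd_rcons u v a b : size u = size v ->
  vadd (rcons u a) (rcons v b) = rcons (vadd u v) (tadd a b).
Proof. by elim: u v => [|c u IHu] [|d v] //= [/IHu->]. Qed.

Lemma all_map_mem (A : eqType) B (p : pred B) (f : A -> B) s x :
  all p (map f s) -> x \in s -> p (f x).
Proof. by rewrite all_map => /allP all_p /all_p. Qed.

Lemma hill_leaves X : X \in slice_reps golay ->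
  all (cap_leaf golay hill) (slice_search slice0 (neighborhoods golay)
    (map (nbhd (neighborhoods golay)) (vecs 5)) X).
Proof.
move=> Xrep; move: hill_checkP; rewrite /hill_check; cbv zeta => /and3P[_ _].
rewrite /hill /leaves lallE; cbv zeta; move=> /all_map_mem/(_ Xrep).
by rewrite lallE; apply.
Qed.

Section Slices.

Variable C : {set 'rV['F_3]_6}.
Hypothesis srgC : strongly_regular 729 112 1 20 (cayley C).
Hypothesis C_slice : slice_cap C.

Let P (k : vec) : bool := rowv 6 (rcons k T1) \in C.

(** These are [level22] and [level22_cap] for the hyperplane at infinity. *)
Lemma neighborhood_count x : size x = 5%N ->
  count (fun k => P (vadd x k)) golay = (if P x then 0 else 5)%N.
Proof.
move=> szx; pose v := rowv 6 (rcons x T1).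
have lv : ev last_form v != 0 by rewrite ev_last_form.
have addE k : k \in golay -> P (vadd x k) = (v + rowv 6 (rcons k T0) \in C).
  move=> /size_golay szk; rewrite /P /v -rowv_add ?size_rcons ?szx ?szk //.
  by rewrite vadd_rcons ?szx.
case: ifP => Px; last first.
  (* [level22] counts differences; applied to [- v], the symmetry of [C] turns them into the sums
     needed here. *)
  have NvC : - v \notin C by rewrite (capN srgC) /v -/(P x) Px.
  have Nlv : ev last_form (- v) != 0 by rewrite evN oppr_eq0.
  have <- := level22 srgC last_form_neq0 (slice_cap_level C_slice) Nlv NvC.
  rewrite (slice_cap_card (fun c => - v - c \in C)) // count_golay.
  apply: eq_in_count => k kg; rewrite addE // embedE ?(size_golay kg) //.
  by rewrite -opprD (capN srgC).
rewrite -[RHS](count_pred0 golay); apply: eq_in_count => k kg /=; rewrite addE //.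
apply/negP; have szk := size_golay kg.
have cl : - rowv 6 (rcons k T0) \in level C last_form 0.
  by rewrite inE (capN srgC) C_slice // kg evN ev_last_form // oppr0 eqxx.
by have := level22_cap srgC lv Px cl; rewrite opprK => /negP.
Qed.

Lemma neighborhood_valid x : size x = 5%N -> valid 5 P (neighborhood golay x).
Proof.
move=> szx; apply/andP; split.
  apply/allP=> wk; rewrite inE => /orP[/eqP->|/mapP[k /size_golay szk ->]]; first by rewrite szx.
  by rewrite (@size_vadd 5).
rewrite inE /mass big_cons big_map /=; apply/eqP.
have -> : (\sum_(k <- golay) 1 * P (vadd x k) = count (fun k => P (vadd x k)) golay)%N.
  by rewrite -sum1_count [RHS]big_mkcond; apply: eq_bigr => k _; case: (P _).
by rewrite neighborhood_count //; case: (P x).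
Qed.

Lemma nbhdE x : size x = 5%N -> nbhd (neighborhoods golay) x = neighborhood golay x.
Proof.
move=> szx; rewrite /nbhd /neighborhoods (get_fold _ (neighborhood golay) _ (n := 5)) //.
by rewrite mem_vecs szx eqxx.
Qed.

Lemma slice_leaf X : X \in slice_reps golay -> {in slice0, forall k, P k = (k \in X)} ->
  exists2 st, consistent 5 P st & cap_leaf golay hill st.
Proof.
move=> + PX.
have nbhd_valid k : size k = 5%N -> valid 5 P (nbhd (neighborhoods golay) k).
  by move=> szk; rewrite nbhdE //; apply: neighborhood_valid.
have touch_valid k b : size k = 5%N ->
    {in touch_slice (neighborhoods golay) k b, forall c, valid 5 P c}.
  move=> szk c; rewrite /touch_slice; case: b; last first.
    by rewrite inE => /eqP->; apply: nbhd_valid.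
  case/mapP=> wk + ->; have /andP[/allP szs _] := nbhd_valid k szk.
  by move=> /szs/eqP; apply: nbhd_valid.
have start : consistent 5 P (start_slice slice0 X).
  move=> k b szk; rewrite /known /start_slice (get_fold _ (fun v => Some (vmem X v)) _ (n := 5)) //.
  by case k0: (k \in slice0) => // -[<-]; rewrite vmemE PX.
have all_valid : {in map (nbhd (neighborhoods golay)) (vecs 5), forall c, valid 5 P c}.
  by move=> _ /mapP[k + ->]; rewrite mem_vecs => /eqP; apply: nbhd_valid.
have todo_valid : {in map (nbhd (neighborhoods golay)) slice0, forall c, valid 5 P c}.
  by move=> _ /mapP[k /slice0P[szk _] ->]; apply: nbhd_valid.
move=> Xrep; apply: (search_sound touch_valid all_valid start todo_valid (depth := 60) (fuel := 2000)).
by have := hill_leaves Xrep; rewrite /slice_search; apply.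
Qed.

Lemma member_cap st v : consistent 5 P st ->
    {in vecs 5, forall k, known st k != None} -> size v = 6%N ->
  member golay st v -> rowv 6 v \in C.
Proof.
move=> cst kn; case/lastP: v => [|k t] //; rewrite size_rcons => -[szk].
have tk : take 5 (rcons k t) = k by rewrite -cats1 -szk take_size_cat.
rewrite /member tk last_rcons; case: t {tk}.
- by rewrite vmemE C_slice.
- by case E: (known st k) => [[]|] // _; apply: cst E.
case E: (known st (vopp k)) => [[]|] // _.
by rewrite -(capN srgC) -rowv_opp /vopp map_rcons; apply: cst E; rewrite size_map.
Qed.

End Slices.

(** The tabulated map is invertible, since the image of [cap] contains the basis, and it sends 112
    distinct vectors into the 112 vectors of [C]. *)
Lemma cap_leaf_form C cap st : strongly_regular 729 112 1 20 (cayley C) -> slice_cap C ->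
    consistent 5 (fun k => rowv 6 (rcons k T1) \in C) st ->
    uniq cap -> {in cap, forall k, size k = 6%N} -> size cap = 112%N ->
    cap_leaf golay cap st ->
  exists2 N, N \in unitmx & forall v, (v *m N \in C) = (v \in map (rowv 6) cap).
Proof.
move=> srgC sC cst cap_uniq cap_size cap112; rewrite /cap_leaf lallE lhasE => /andP[/allP kn /hasP[ws wsin]].
cbv zeta; case: ifP => //; rewrite !lallE => /allP sub /allP img.
have [szws szw] : size ws = 6%N /\ all (fun w => size w == 6%N) ws.
  have : all (fun ws => (size ws == 6%N) && all (fun w => size w == 6%N) ws) isomorphisms.
    by vm_compute.
  by move=> /allP/(_ _ wsin)/andP[/eqP].
have {}kn : {in vecs 5, forall k, known st k != None}.
  by move=> k /kn; case: (known st k).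
set N := rowsv 6 6 ws.
have linE c : c \in cap -> rowv 6 (lin 6 c ws) = rowv 6 c *m N.
  by move=> /cap_size szc; apply: rowv_lin.
have Nu : N \in unitmx.
  rewrite -row_full_unit -sub1mx; apply/row_subP=> i.
  rewrite row1 -rowv_unitv; have := img _ (basis_unitv (ltn_ord i)).
  by rewrite vmemE => /mapP[c ch ->]; rewrite linE // submxMl.
exists N => // v.
have injN : injective (fun v : 'rV_6 => v *m N) by apply: can_inj (mulmxK Nu).
suff imC : [set v *m N | v in map (rowv 6) cap] = C by rewrite -imC (mem_imset _ _ injN).
have card112 : #|map (rowv 6) cap| = 112%N.
  rewrite (card_uniqP _) ?size_map // map_inj_in_uniq // => u w /cap_size szu /cap_size szw'.
  exact: rowv_inj.
apply/eqP; rewrite eqEcard card_imset // card112 (cap_card srgC) leqnn andbT.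
apply/subsetP=> _ /imsetP[w /mapP[c ch ->] ->].
rewrite -linE //; apply: (member_cap srgC sC cst kn); first by rewrite size_lin.
by apply: sub; apply: map_f.
Qed.

Definition hill_set : {set 'rV['F_3]_6} := [set v in map (rowv 6) hill].

Lemma uniq_hill : uniq hill.
Proof. by rewrite /hill /hill_of; cbv zeta; apply: filter_uniq; apply: uniq_vecs. Qed.

Lemma mem_hill_size k : k \in hill -> size k = 6%N.
Proof.
by rewrite /hill /hill_of; cbv zeta; rewrite mem_filter mem_vecs => /andP[_ /eqP].
Qed.

Lemma size_hill : size hill = 112%N.
Proof. by have := hill_checkP; rewrite /hill_check; cbv zeta => /and3P[/eqP]. Qed.

Lemma cap_unique C : strongly_regular 729 112 1 20 (cayley C) ->
  exists2 M, M \in unitmx & forall v, (v *m M \in C) = (v \in hill_set).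
Proof.
move=> srgC; have [D [X [Du Xrep sC PX]]] := canonical_slice srgC.
have srgD := moved_srg Du srgC.
have [st cst leaf] := slice_leaf srgD sC Xrep PX.
have [N Nu NC] := cap_leaf_form srgD sC cst uniq_hill mem_hill_size size_hill leaf.
exists (N *m D); first by rewrite unitmx_mul Nu; exact: Du.
by move=> v; clear -NC; rewrite [RHS]inE -(NC v) inE mulmxA.
Qed.

Lemma hill_form (T : finType) (e : rel T) : strongly_regular 729 112 1 20 e ->
  exists2 f : 'rV['F_3]_6 -> T, bijective f & forall u v, e (f u) (f v) = (v - u \in hill_set).
Proof.
move=> srg_e; have [f fbij fe] := cayley_form srg_e.
pose C := [set v | e (f 0) (f v)].
have eC u v : e (f u) (f v) = cayley C u v.
  by rewrite /cayley [RHS]inE -(fe 0 _ u) add0r subrK.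
have [M Mu MC] := cap_unique (srg_iso fbij eC srg_e).
exists (fun v => f (v *m M)).
  apply: (bij_comp fbij); exists (mulmxr (invmx M)) => v /=; first exact: mulmxK.
  exact: mulmxKV.
by move=> u v; rewrite eC /cayley -mulmxBl MC.
Qed.

Local Close Scope ring_scope.

Theorem theorem2 (T1 T2 : finType) (e1 : rel T1) (e2 : rel T2)
    (srg1 : strongly_regular 729 112 1 20 e1)
    (srg2 : strongly_regular 729 112 1 20 e2) :
  graph_isomorphic e1 e2.
Proof.
have [f [g fK gK] fe] := hill_form srg1; have [f' f'bij fe'] := hill_form srg2.
exists (f' \o g); first by apply: bij_comp => //; exists f.
by move=> x y; rewrite /= fe' -fe !gK.
Qed.
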